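(* Let $\Sigma$ be a $3$-chromatic signed graph, given as input to the algorithm MaxDef (Steps 1–12 described in the context). If $\Sigma$ is without multiple edges of the same sign, then MaxDef has running time $\mathcal O(V^5)$, where $V$ denotes the number of vertices of $\Sigma$.
   Context: **Definitions.** A signed graph $\Sigma=(V,E,\sigma)$ is a graph $(V,E)$ with a signature $\sigma:E\to\{+,-\}$; here it need not be simple. A proper coloration is a function $\kappa$ from $V$ to a color set such that $\kappa(a)\neq\sigma(e)\kappa(b)$ for every edge $e$ with endpoints $a,b$. The color set of size $2k$ is $\{\pm1,\dots,\pm k\}$ and that of size $2k+1$ is $\{\pm1,\dots,\pm k,0\}$. The chromatic number $\chi(\Sigma)$ is the size of the smallest color set with which $\Sigma$ can be properly colored; $\Sigma$ is $3$-chromatic if $\chi(\Sigma)=3$. A coloration is minimal if it is proper and its color set has size $\chi(\Sigma)$ (for a $3$-chromatic graph the color set is $\{1,-1,0\}$). The deficiency of a coloration is the number of unused colors of its color set, and $\operatorname{M}(\Sigma)$ is the maximum deficiency over all minimal proper colorations of $\Sigma$; for $3$-chromatic $\Sigma$ it is $0$ or $1$. $E^{+}$ and $E^{-}$ are the sets of positive and negative edges, $\Sigma^+$ is the subgraph of positive edges, and $V^+$ is the set of vertices incident with at least one positive edge. For a derived signed graph such as $\Sigma_1$, the notations $V_1$, $E_1^+$, $E_1^-$ have the corresponding meaning. A set of vertices is stable in $\Sigma$ if it induces a subgraph with no edges. A vertex cover of $E^+$ is a set of vertices meeting every edge of $E^+$; a stable cover is a vertex cover of $E^+$ that is stable in $\Sigma$.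 **The algorithm MaxDef.** Input: a $3$-chromatic, not necessarily simple, signed graph $\Sigma$, given as two arrays of adjacency lists (positive adjacencies and negative adjacencies). Output: the maximum deficiency, $0$ or $1$, along with a stable vertex cover of $E^+$ if the maximum deficiency is $1$. Throughout, $S$ is a partial stable cover and $B$ is a list of vertices forbidden from $S$; initially $S=B=\emptyset$. Recovery information about which vertices have been identified together is stored. $N_-(v)$ is the set of vertices (of the current graph) negatively adjacent to $v$. ''$X\rightarrow Y$'' means replace $Y$ by $X$. ''$\operatorname{M}(\Sigma)=0$'' or ''$\operatorname{M}(\Sigma)=1$'' in a step means the algorithm ends with that answer. Step 1: Delete all vertices of $\Sigma$ not in $V^+$; call the result $\Sigma_{01}$. Step 2: Let $H_1,\dots,H_r$ be the connected components of $\Sigma_{01}^+$. If some $H_i$ is not bipartite, then $\operatorname{M}(\Sigma)=0$. Otherwise, let $A_i,B_i$ be the parts of the unique bipartition of $H_i$; collapse each $A_i$ to a vertex $a_i$ and each $B_i$ to a vertex $b_i$, eliminate multiple edges of the same sign, and delete the negative edge $a_ib_i$ if it exists. (Negative edges inside $A_i$ or $B_i$ become loops.) The result $\Sigma_{02}$ is a positive perfect matching with all other edges negative. For a matched pair $(a_i,b_i)$, $x_i$ denotes one vertex of the pair and $\bar x_i$ the other. Set $\Sigma_1=\Sigma_{02}$. Step 3: If there is an $i$ with $x_i$ and $\bar x_i$ both in $B$, then $\operatorname{M}(\Sigma)=0$. Otherwise go to Step 4. Step 4: If there is an $i$ with $x_i\in B$, then $S\cup\{\bar x_i\}\rightarrow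 S$, $(B\cup N_-(\bar x_i))\setminus\{x_i\}\rightarrow B$, $\Sigma_1\setminus\{x_i,\bar x_i\}\rightarrow\Sigma_1$, and return to Step 3. Otherwise go to Step 5. Step 5: If there is an $i$ such that $x_i$ and $\bar x_i$ both have loops, then $\operatorname{M}(\Sigma)=0$. Otherwise go to Step 6. Step 6: If there is an $i$ such that $x_i$ has a loop, then $S\cup\{\bar x_i\}\rightarrow S$, $B\cup N_-(\bar x_i)\rightarrow B$, $\Sigma_1\setminus\{x_i,\bar x_i\}\rightarrow\Sigma_1$, and return to Step 3. Otherwise go to Step 7. Step 7: If there is an $i$ such that $x_i$ is adjacent to both $x_j$ and $\bar x_j$ (for some $j$), then $S\cup\{\bar x_i\}\rightarrow S$, $B\cup N_-(\bar x_i)\rightarrow B$, $\Sigma_1\setminus\{x_i,\bar x_i\}\rightarrow\Sigma_1$, and return to Step 3. Otherwise go to Step 8. Step 8: If there are $i\neq j$ such that $x_i$ is adjacent to $x_j$ and $\bar x_i$ is adjacent to $\bar x_j$, then identify $x_i$ with $\bar x_j$ and $\bar x_i$ with $x_j$ in $\Sigma_1$ (removing duplicate edges of the same sign), delete the negative edge $x_i\bar x_i$, and return to Step 3. Otherwise go to Step 9. Step 9: If there is a vertex of degree one, call it $x_i$; then $S\cup\{x_i\}\rightarrow S$, $B\cup N_-(x_i)\rightarrow B$, $\Sigma_1\setminus\{x_i,\bar x_i\}\rightarrow\Sigma_1$ (if $x_i$ and $\bar x_i$ both have degree one, only one of them, it does not matter which, is placed in $S$), and return to Step 3. Otherwise go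 to Step 10. Step 10: If $\Sigma_1$ is the empty graph, then $\operatorname{M}(\Sigma)=1$; use the recovery information to produce a stable cover of $E^+$. Otherwise go to Step 11. Step 11: Create the forcing graph $F(\Sigma_1)$, the directed graph with vertex set $V_1$ and directed edge set $\{x_ix_j : x_i\bar x_j\in E_1^-\}$. Since $\Sigma_1$ has no vertices of degree one, $F(\Sigma_1)$ has minimum outdegree at least $1$, so it contains a directed cycle; and since $x_ix_j$ is an edge if and only if $\bar x_j\bar x_i$ is, there are two cycles, possibly not disjoint: if one uses vertices $x_1,\dots,x_r$, the other uses $\bar x_1,\dots,\bar x_r$. Find such a pair of cycles. Step 12: If the two cycles found in Step 11 are not disjoint, then $\operatorname{M}(\Sigma)=0$. If they are disjoint, identify in $\Sigma_1$ the vertices belonging to each of the two cycles (each cycle to one vertex), eliminate multiple edges of the same sign, delete any negative edge $x_i\bar x_i$, let the result be the new $\Sigma_1$, and return to Step 3. **Data format.** The signed graph is stored as two arrays of adjacency lists, one for positive and one for negative edges (the positive lists are no longer updated after Step 2); the current forcing graph is stored as adjacency lists; $S$ and $B$ are stored as lists; the recovery information is stored as an array of lists, one list for each group of identified vertices. Adding, moving, changing or deleting a list element takes constant time. Bipartiteness in Step 2 and a cycle of the forcing graph are found by depth-first search. *)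

(* Defs.v *)
From mathcomp Require Import all_boot ssralg ssrnum ssrint.

Set Implicit Arguments.
Unset Strict Implicit.
Unset Printing Implicit Defensive.

(** * Signed graphs and colorations *)

(* Loops and parallel edges are allowed.  The order of the two ends of an edge
   carries no meaning. *)
Record signed_graph := SignedGraph {
  vertex : finType;
  edge : finType;
  ends : edge -> vertex * vertex;
  positive : edge -> bool
}.

Section SignedGraph.
Variable G : signed_graph.
Implicit Types (e f : edge G) (v : vertex G).

Definition same_ends e f : bool :=
  (ends e == ends f) || (ends e == ((ends f).2, (ends f).1)).

Definition no_multiple_edges_of_same_sign : Prop :=
  forall e f, positive e = positive f -> same_ends e f -> e = f.

Definition sigma e : int := if positive e then 1%R else (-1)%R.

(* {-k, ..., -1, 1, ..., k} for size 2k, and the same set with 0 for 2k+1. *)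
Definition in_color_set (k : nat) (c : int) : bool :=
  (absz c <= k./2) && ((c == 0%R) ==> odd k).

Definition proper_coloration (kappa : vertex G -> int) : Prop :=
  forall e, kappa (ends e).1 <> (sigma e * kappa (ends e).2)%R.

Definition colorable (k : nat) : Prop :=
  exists kappa : vertex G -> int,
    (forall v, in_color_set k (kappa v)) /\ proper_coloration kappa.

Definition has_chromatic_number (chi : nat) : Prop :=
  colorable chi /\ forall k, colorable k -> chi <= k.

Definition three_chromatic : Prop := has_chromatic_number 3.

Definition incident e v : bool := ((ends e).1 == v) || ((ends e).2 == v).

Definition opposite e v : vertex G :=
  if (ends e).1 == v then (ends e).2 else (ends e).1.

(* [A] is an array of adjacency lists for the edges of sign [s] when vertex [v]
   is stored as the number [num v].  A list has one entry per incident edge (a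
   loop counts once), in any order. *)
Definition adjacency_lists (num : vertex G -> 'I_#|vertex G|) (s : bool)
    (A : seq (seq nat)) : Prop :=
  size A = #|vertex G| /\
  forall v, perm_eq (nth [::] A (num v))
    [seq val (num (opposite e v)) |
       e <- enum (edge G) & (positive e == s) && incident e v].

Definition represented_by (pos neg : seq (seq nat)) : Prop :=
  exists num : vertex G -> 'I_#|vertex G|,
    [/\ bijective num, adjacency_lists num true pos
      & adjacency_lists num false neg].

End SignedGraph.

(** * Programs with a running time *)

(* A program is run with a time budget; it returns its value and the time left,
   or [None] if it does not terminate within the budget.  The definitions of
   this part are the only ones that look inside [prog], inspect or build lists
   and arrays, or recurse: everything after them is composed from these
   primitives, plus a bounded number of comparisons and arithmetic operations
   on vertex numbers between two of them. *)
Definition prog (A : Type) := nat -> option (A * nat).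

Definition terminates_within A (p : prog A) (t : nat) : Prop := isSome (p t).

Definition ret A (a : A) : prog A := fun t => Some (a, t).

Definition bind A B (p : prog A) (q : A -> prog B) : prog B :=
  fun t => if p t is Some (a, t') then q a t' else None.

Notation "'let!' x := p 'in' q" := (bind p (fun x => q))
  (at level 200, x name, p at level 100, q at level 200).
Notation "'let!' ' x := p 'in' q" := (bind p (fun x => q))
  (at level 200, x strict pattern, p at level 100, q at level 200).

Definition ticks (k : nat) : prog unit :=
  fun t => if k <= t then Some (tt, t - k) else None.

(* Stands in the branches that no input of the algorithm should reach. *)
Definition diverge A : prog A := fun=> None.
Arguments diverge {A}.

(* Repeats [body] until it returns [inr].  Since every iteration takes at least
   one unit of time, [t.+1] iterations exceed a budget of [t]. *)
Fixpoint loop_rec A B (k : nat) (body : A -> prog (A + B)) (a : A) : prog B :=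
  if k is k'.+1 then
    let! _ := ticks 1 in
    let! r := body a in
    match r with inl a' => loop_rec k' body a' | inr b => ret b end
  else diverge.

Definition loop A B (body : A -> prog (A + B)) (a : A) : prog B :=
  fun t => loop_rec t.+1 body a t.

Definition push A (x : A) (l : seq A) : prog (seq A) :=
  let! _ := ticks 1 in ret (x :: l).

Definition pop A (l : seq A) : prog (option (A * seq A)) :=
  let! _ := ticks 1 in ret (if l is x :: l' then Some (x, l') else None).

Fixpoint for_each A B (f : B -> A -> prog B) (b : B) (l : seq A) : prog B :=
  let! _ := ticks 1 in
  if l is x :: l' then let! b' := f b x in for_each f b' l' else ret b.

Fixpoint find_first A (p : A -> prog bool) (l : seq A) : prog (option A) :=
  let! _ := ticks 1 in
  if l is x :: l' then
    let! b := p x in if b then ret (Some x) else find_first p l'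
  else ret None.

Fixpoint keep A (p : A -> prog bool) (l : seq A) : prog (seq A) :=
  let! _ := ticks 1 in
  if l is x :: l' then
    let! b := p x in
    let! r := keep p l' in
    if b then push x r else ret r
  else ret [::].

Definition numbers_below (n : nat) : prog (seq nat) :=
  let! _ := ticks n in ret (iota 0 n).

Definition new_array A (n : nat) (x : A) : prog (seq A) :=
  let! _ := ticks n in ret (nseq n x).

Definition array_length A (a : seq A) : prog nat :=
  let! _ := ticks 1 in ret (size a).

Definition array_get A (x0 : A) (a : seq A) (i : nat) : prog A :=
  let! _ := ticks 1 in ret (nth x0 a i).

Definition array_set A (x0 : A) (a : seq A) (i : nat) (x : A) : prog (seq A) :=
  let! _ := ticks 1 in ret (set_nth x0 a i x).

(** * Lists of vertices and arrays of lists *)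

Definition is_empty A (l : seq A) : prog bool :=
  let! c := pop l in ret (~~ isSome c).

Definition count_cells A (l : seq A) : prog nat :=
  for_each (fun k _ => ret k.+1) 0 l.

Definition list_mem (x : nat) (l : seq nat) : prog bool :=
  let! o := find_first (fun y => ret (y == x)) l in ret (isSome o).

Definition list_remove (x : nat) (l : seq nat) : prog (seq nat) :=
  keep (fun y => ret (y != x)) l.

Definition list_insert (x : nat) (l : seq nat) : prog (seq nat) :=
  let! b := list_mem x l in if b then ret l else push x l.

Definition list_union (l1 l2 : seq nat) : prog (seq nat) :=
  for_each (fun l x => list_insert x l) l1 l2.

Definition lists := seq (seq nat).

Definition get_list (a : lists) (v : nat) : prog (seq nat) := array_get [::] a v.

Definition set_list (a : lists) (v : nat) (l : seq nat) : prog lists :=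
  array_set [::] a v l.

Definition adjacent (a : lists) (v w : nat) : prog bool :=
  let! l := get_list a v in list_mem w l.

Definition push_at (a : lists) (v w : nat) : prog lists :=
  let! l := get_list a v in
  let! l' := push w l in
  set_list a v l'.

Definition insert_at (a : lists) (v w : nat) : prog lists :=
  let! l := get_list a v in
  let! l' := list_insert w l in
  set_list a v l'.

Definition remove_at (a : lists) (v w : nat) : prog lists :=
  let! l := get_list a v in
  let! l' := list_remove w l in
  set_list a v l'.

(** * The algorithm *)

Inductive answer :=
| Deficiency0
| Deficiency1 of seq nat. (* a stable cover of the positive edges *)

(* The current graph Sigma_1 with the lists S and B.  [groups] is the recovery
   information: [groups] at [x] lists the input vertices identified to [x].
   Entries of the arrays at vertices outside [verts] are not used, except for
   the groups of members of S. *)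
Record state := State {
  verts : seq nat;
  pos_adj : lists;
  neg_adj : lists;
  groups : lists;
  cover_S : seq nat;     (* S *)
  forbidden_B : seq nat  (* B *)
}.

Definition with_verts st vs :=
  State vs (pos_adj st) (neg_adj st) (groups st) (cover_S st) (forbidden_B st).
Definition with_neg st ng :=
  State (verts st) (pos_adj st) ng (groups st) (cover_S st) (forbidden_B st).
Definition with_group st gr :=
  State (verts st) (pos_adj st) (neg_adj st) gr (cover_S st) (forbidden_B st).
Definition with_cover st s :=
  State (verts st) (pos_adj st) (neg_adj st) (groups st) s (forbidden_B st).
Definition with_forbidden st b :=
  State (verts st) (pos_adj st) (neg_adj st) (groups st) (cover_S st) b.

(* The vertex matched to [x]: the only entry of its positive adjacency list. *)
Definition bar (st : state) (x : nat) : prog nat :=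
  let! l := get_list (pos_adj st) x in
  let! c := pop l in
  if c is Some (y, _) then ret y else diverge.

Definition delete_vertex (st : state) (x : nat) : prog state :=
  let! l := get_list (neg_adj st) x in
  let! ng := for_each (fun ng u => remove_at ng u x) (neg_adj st) l in
  let! ng := set_list ng x [::] in
  let! vs := list_remove x (verts st) in
  ret (with_verts (with_neg st ng) vs).

(* Puts [x] in S and its negative neighbors in B, and deletes its pair. *)
Definition select (st : state) (x : nat) : prog state :=
  let! y := bar st x in
  let! s := push x (cover_S st) in
  let! l := get_list (neg_adj st) x in
  let! b := list_union (forbidden_B st) l in
  let st := with_forbidden (with_cover st s) b in
  let! st := delete_vertex st x in
  delete_vertex st y.

(* Identifies [z] with [w], under the name [w]. *)
Definition identify (w : nat) (st : state) (z : nat) : prog state :=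
  let! l := get_list (neg_adj st) z in
  let! ng := for_each (fun ng u =>
      let u' := if u == z then w else u in
      let! ng := remove_at ng u z in
      let! ng := insert_at ng u' w in
      insert_at ng w u') (neg_adj st) l in
  let! ng := set_list ng z [::] in
  let! vs := list_remove z (verts st) in
  let! g := get_list (groups st) z in
  let! gr := for_each (fun gr v => push_at gr w v) (groups st) g in
  ret (with_group (with_verts (with_neg st ng) vs) gr).

Definition delete_negative_edge (st : state) (x y : nat) : prog state :=
  let! ng := remove_at (neg_adj st) x y in
  let! ng := remove_at ng y x in
  ret (with_neg st ng).

(** ** Steps 1 and 2 *)

Definition step1 (pos neg : lists) : prog (seq nat * lists) :=
  let in_Vplus v := let! l := get_list pos v in
                    let! e := is_empty l in ret (~~ e) in
  let! n := array_length pos in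
  let! vs := numbers_below n in
  let! vs := keep in_Vplus vs in
  let! neg := for_each (fun neg v =>
      let! l := get_list neg v in
      let! l := keep in_Vplus l in
      set_list neg v l) neg vs in
  ret (vs, neg).

(* The vertices a_i and b_i of the collapsed graph are numbered 2i and 2i+1. *)
Definition other_part (c : nat) : nat := if odd c then c.-1 else c.+1.

Definition labels := seq (option nat).

Definition get_label (lab : labels) (v : nat) : prog (option nat) :=
  array_get None lab v.

(* Depth-first search labelling the component of [v] with [c] and [other_part c];
   the stack holds vertices to visit with the label they must have.  Returns
   [None] if the component is not bipartite. *)
Definition label_component (pos : lists) (lab : labels) (v c : nat) :
    prog (option labels) :=
  loop (fun s : seq (nat * nat) * labels =>
    let '(stack, lab) := s in
    let! top := pop stack in
    if top is Some ((v, c), stack') then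
      let! o := get_label lab v in
      if o is Some d then
        if d == c then ret (inl (stack', lab)) else ret (inr None)
      else
        let! lab' := array_set None lab v (Some c) in
        let! l := get_list pos v in
        let! stack'' :=
          for_each (fun stack w => push (w, other_part c) stack) stack' l in
        ret (inl (stack'', lab'))
    else ret (inr (Some lab)))
  ([:: (v, c)], lab).

(* The labels of all vertices and the number of components, or [None] if some
   component is not bipartite. *)
Definition label_components (pos : lists) (vs : seq nat) :
    prog (option (labels * nat)) :=
  let! n := array_length pos in
  let! lab := new_array n None in
  for_each (fun (acc : option (labels * nat)) v =>
    if acc is Some (lab, r) then
      let! o := get_label lab v in
      if o is Some _ then ret acc
      else
        let! res := label_component pos lab v r.*2 in
        if res is Some lab' then ret (Some (lab', r.+1)) else ret None
    else ret None) (Some (lab, 0)) vs.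

Definition collapse (vs : seq nat) (neg : lists) (lab : labels) (r : nat) :
    prog state :=
  let label v := let! o := get_label lab v in
                 if o is Some c then ret c else diverge in
  let! vs1 := numbers_below r.*2 in
  let! empty := new_array r.*2 [::] in
  let! pos1 := for_each (fun pos1 c => push_at pos1 c (other_part c)) empty vs1 in
  let! empty := new_array r.*2 [::] in
  let! gr := for_each (fun gr v => let! c := label v in push_at gr c v) empty vs in
  let! empty := new_array r.*2 [::] in
  let! neg1 := for_each (fun neg1 v =>
      let! c := label v in
      let! l := get_list neg v in
      for_each (fun neg1 w =>
        let! d := label w in
        if d == other_part c then ret neg1 else insert_at neg1 c d) neg1 l)
    empty vs in
  ret (State vs1 pos1 neg1 gr [::] [::]).

Definition step2 (pos : lists) (vs : seq nat) (neg : lists) :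
    prog (option state) :=
  let! res := label_components pos vs in
  if res is Some (lab, r) then
    let! st := collapse vs neg lab r in ret (Some st)
  else ret None.

(** ** Steps 3 to 12 *)

(* Each step either goes on to the next one, or returns: [inl st] goes back to
   [step3] with [st], [inr a] ends the algorithm with [a]. *)
Definition outcome := (state + answer)%type.

(* [c] is the list of vertices of the cycle found in [step11]. *)
Definition step12 (st : state) (c : seq nat) : prog outcome :=
  let! c' := for_each (fun c' x => let! y := bar st x in push y c') [::] c in
  let! common := find_first (fun x => list_mem x c') c in
  if common is Some _ then ret (inr Deficiency0) else
  let! h := pop c in
  if h is Some (x, rest) then
    let! y := bar st x in
    let! rest' := list_remove y c' in
    let! st := for_each (identify x) st rest in
    let! st := for_each (identify y) st rest' in
    let! st := delete_negative_edge st x y in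
    ret (inl st)
  else diverge.

Definition forcing_graph (st : state) : prog lists :=
  let! n := array_length (neg_adj st) in
  let! empty := new_array n [::] in
  for_each (fun F x =>
    let! l := get_list (neg_adj st) x in
    for_each (fun F y => let! z := bar st y in push_at F x z) F l)
  empty (verts st).

Inductive mark := Unvisited | OnStack | Finished.

(* The vertices on the stack, from the top down to [w]. *)
Definition path_down_to (w : nat) (stack : seq (nat * seq nat)) :
    prog (seq nat) :=
  loop (fun s : seq (nat * seq nat) * seq nat =>
    let '(stack, path) := s in
    let! top := pop stack in
    if top is Some ((v, _), stack') then
      let! path' := push v path in
      if v == w then ret (inr path') else ret (inl (stack', path'))
    else ret (inr path))
  (stack, [::]).

(* Depth-first search in [F].  A stack entry is a vertex with the part of its
   list still to be explored; an arc to a vertex on the stack closes a cycle. *)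
Definition find_cycle (F : lists) (vs : seq nat) : prog (option (seq nat)) :=
  let! n := array_length F in
  let! marks := new_array n Unvisited in
  loop (fun s : (seq nat * seq (nat * seq nat)) * seq mark =>
    let '((roots, stack), marks) := s in
    let visit v roots stack :=
      let! marks' := array_set Unvisited marks v OnStack in
      let! l := get_list F v in
      let! stack' := push (v, l) stack in
      ret (inl ((roots, stack'), marks')) in
    let! top := pop stack in
    if top is Some ((v, l), stack') then
      let! c := pop l in
      if c is Some (w, l') then
        let! m := array_get Unvisited marks w in
        match m with
        | Unvisited => let! stack'' := push (v, l') stack' in
                       visit w roots stack''
        | OnStack => let! p := path_down_to w stack in ret (inr (Some p))
        | Finished => let! stack'' := push (v, l') stack' in
                      ret (inl ((roots, stack''), marks))
        end
      else
        let! marks' := array_set Unvisited marks v Finished in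
        ret (inl ((roots, stack'), marks'))
    else
      let! c := pop roots in
      if c is Some (v, roots') then
        let! m := array_get Unvisited marks v in
        if m is Unvisited then visit v roots' [::]
        else ret (inl ((roots', [::]), marks))
      else ret (inr None))
  ((vs, [::]), marks).

Definition step11 (st : state) : prog outcome :=
  let! F := forcing_graph st in
  let! o := find_cycle F (verts st) in
  if o is Some c then step12 st c else diverge.

Definition step10 (st : state) : prog outcome :=
  let! e := is_empty (verts st) in
  if e then
    let! l := for_each (fun l x =>
        let! g := get_list (groups st) x in
        for_each (fun l v => push v l) l g) [::] (cover_S st) in
    ret (inr (Deficiency1 l))
  else step11 st.

Definition step9 (st : state) : prog outcome :=
  let! o := find_first (fun x =>
      let! lp := get_list (pos_adj st) x in
      let! ln := get_list (neg_adj st) x in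
      let! dp := count_cells lp in
      let! dn := count_cells ln in
      ret (dp + dn == 1)) (verts st) in
  if o is Some x then let! st := select st x in ret (inl st)
  else step10 st.

(* A neighbor [y] of [x] in another pair whose mate is a neighbor of the mate of
   [x]. *)
Definition opposite_neighbor (st : state) (x : nat) : prog (option nat) :=
  let! x' := bar st x in
  let! l := get_list (neg_adj st) x in
  find_first (fun y =>
    let! y' := bar st y in
    let! b := adjacent (neg_adj st) x' y' in
    ret [&& b, y != x & y != x']) l.

Definition step8 (st : state) : prog outcome :=
  let! o := find_first (fun x =>
      let! r := opposite_neighbor st x in ret (isSome r)) (verts st) in
  if o is Some x then
    let! r := opposite_neighbor st x in
    if r is Some y then
      let! x' := bar st x in
      let! y' := bar st y in
      let! st := identify x st y' in
      let! st := identify x' st y in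
      let! st := delete_negative_edge st x x' in
      ret (inl st)
    else diverge
  else step9 st.

Definition select_bar (st : state) (x : nat) : prog state :=
  let! x' := bar st x in select st x'.

Definition step7 (st : state) : prog outcome :=
  let! o := find_first (fun x =>
      let! l := get_list (neg_adj st) x in
      let! r := find_first (fun y => let! y' := bar st y in list_mem y' l) l in
      ret (isSome r)) (verts st) in
  if o is Some x then let! st := select_bar st x in ret (inl st)
  else step8 st.

Definition has_loop (st : state) (x : nat) : prog bool :=
  adjacent (neg_adj st) x x.

Definition step6 (st : state) : prog outcome :=
  let! o := find_first (has_loop st) (verts st) in
  if o is Some x then let! st := select_bar st x in ret (inl st)
  else step7 st.

Definition step5 (st : state) : prog outcome :=
  let! o := find_first (fun x =>
      let! x' := bar st x in
      let! b := has_loop st x in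
      let! b' := has_loop st x' in
      ret (b && b')) (verts st) in
  if o is Some _ then ret (inr Deficiency0) else step6 st.

Definition step4 (st : state) : prog outcome :=
  let! o := find_first (fun x => list_mem x (forbidden_B st)) (verts st) in
  if o is Some x then
    let! st := select_bar st x in
    let! b := list_remove x (forbidden_B st) in
    ret (inl (with_forbidden st b))
  else step5 st.

Definition step3 (st : state) : prog outcome :=
  let! o := find_first (fun x =>
      let! x' := bar st x in
      let! b := list_mem x (forbidden_B st) in
      let! b' := list_mem x' (forbidden_B st) in
      ret (b && b')) (verts st) in
  if o is Some _ then ret (inr Deficiency0) else step4 st.

Definition MaxDef (pos neg : lists) : prog answer :=
  let! '(vs, neg) := step1 pos neg in
  let! o := step2 pos vs neg in
  if o is Some st then loop step3 st else ret Deficiency0.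

(* Main.v *)
Require Import Defs.
From mathcomp Require Import all_boot.
From mathcomp Require Import zify.

Set Implicit Arguments.
Unset Strict Implicit.
Unset Printing Implicit Defensive.

(* Every return to Step 3 has removed a vertex of the current graph, whose vertices
   number at most [N = 2V], so Steps 3 to 12 are run O(V) times.  One round costs
   O(V^3), because the adjacency lists and [B] never hold a vertex twice and have
   length at most [N], and because the groups of identified vertices are disjoint;
   Steps 1 and 2 cost O(V^3).

   No branch diverges: in Step 11 every vertex has a successor in the forcing graph, so
   a depth-first search meets its own stack before it backtracks.  The cycle found has
   at least two vertices, as no negative edge joins the two vertices of a pair; this is
   why Step 12 shrinks the graph. *)

(** * Running time of programs *)

(** [runs] is a Hoare triple with a cost. It bounds the time spent from every sufficient budget, so
    costs add along [bind] and may be rounded up freely. The obstacle is that the cost of a list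
    operation depends on lengths, hence on what the program has done before: each cost bound is
    proved together with an invariant that keeps the lists short. These invariants rest on
    structural facts: the negative lists are symmetric (deleting or identifying a vertex visits the
    lists of its own neighbors alone), the positive lists are exactly the matching of 2i with 2i+1,
    and no negative edge lies inside a pair.

    All lengths are measured by the same [N], so each nested traversal multiplies the cost by a
    factor [N]. The array length [M] of the collapsed graph, twice the number of components, is kept
    apart from [N]. The constants are mere upper bounds: since each step calls the next one, they
    grow from Step 12 back to Step 3, rounded so that the arithmetic side conditions close
    automatically. The total is O(V^4), and V^4 <= V^5 because a 3-chromatic graph has a vertex. *)

Variant runs A (p : prog A) (k : nat) (Q : A -> Prop) : Prop :=
  Runs of forall t, k <= t ->
    exists a t', [/\ p t = Some (a, t'), t <= t' + k & Q a].

Lemma runs_ret A (a : A) k (Q : A -> Prop) : Q a -> runs (ret a) k Q.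
Proof. by move=> Qa; split=> t _; exists a, t; split=> //; lia. Qed.

Lemma runs_ticks n : runs (ticks n) n (fun=> True).
Proof. by split=> t le_nt; exists tt, (t - n); rewrite /ticks le_nt; split=> //; lia. Qed.

Lemma runs_bind A B (p : prog A) (q : A -> prog B) k1 k Q1 Q :
  runs p k1 Q1 -> k1 <= k -> (forall a, Q1 a -> runs (q a) (k - k1) Q) ->
  runs (bind p q) k Q.
Proof.
case=> Hp le_k Hq; split=> t le_kt; rewrite /bind.
have [a [t1 [-> t1P Q1a]]] := Hp t (leq_trans le_k le_kt).
have [{}Hq] := Hq a Q1a.
have [|b [t2 [-> t2P Qb]]] := Hq t1; first by lia.
by exists b, t2; split=> //; lia.
Qed.

Lemma runs_weaken A (p : prog A) k1 k (Q1 Q : A -> Prop) :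
  runs p k1 Q1 -> k1 <= k -> (forall a, Q1 a -> Q a) -> runs p k Q.
Proof.
case=> Hp le_k QQ; split=> t le_kt; have [a [t' [-> t'P Q1a]]] := Hp t (leq_trans le_k le_kt).
by exists a, t'; split; [|lia|exact: QQ].
Qed.

(** Amortized analysis with the potential [phi]: an iteration lowers it by more than its own cost,
    and the strictness pays the unit that [loop] charges. *)
Lemma runs_loop A B (body : A -> prog (A + B)) (Inv : A -> Prop)
    (phi : A -> nat) (Q : B -> Prop) :
  (forall a, Inv a -> exists2 k, k < phi a &
     runs (body a) k (fun r => match r with
       | inl a' => Inv a' /\ phi a' + k < phi a
       | inr b => Q b end)) ->
  forall a, Inv a -> runs (loop body a) (phi a) Q.
Proof.
move=> Hbody.
(* The fuel [n] is separated from the budget [t], because they decrease at different rates; the fuel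
   lasts since every iteration lowers [phi] by at least one. *)
have loop_recP n a t : Inv a -> phi a < n -> phi a <= t -> exists b t',
    [/\ loop_rec n body a t = Some (b, t'), t <= t' + phi a & Q b]; last first.
  by move=> a Ia; split=> t le_t; apply: loop_recP => //; lia.
elim: n a t => [//|n IHn] a t Ia lt_n le_t /=.
have [k lt_k [Hk]] := Hbody a Ia.
rewrite {1}/bind /ticks (leq_trans _ le_t); last by lia.
have [|r [t1 [E t1P Hr]]] := Hk (t - 1); first by lia.
rewrite /bind E; case: r Hr {E} => [a' [Ia' lt_phi]|b Qb]; last first.
  by exists b, t1; split=> //; lia.
have [||b [t2 [-> t2P Qb]]] := IHn a' t1 Ia'; [lia|lia|].
by exists b, t2; split=> //; lia.
Qed.

Lemma runs_push A (x : A) l : runs (push x l) 1 (fun r => r = x :: l).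
Proof. by rewrite /push; apply: (runs_bind (runs_ticks 1)) => // *; apply: runs_ret. Qed.

Lemma runs_pop A (l : seq A) :
  runs (pop l) 1 (fun r => r = if l is x :: l' then Some (x, l') else None).
Proof. by rewrite /pop; apply: (runs_bind (runs_ticks 1)) => // *; apply: runs_ret. Qed.

Lemma runs_array_get A (x0 : A) a i :
  runs (array_get x0 a i) 1 (fun r => r = nth x0 a i).
Proof. by rewrite /array_get; apply: (runs_bind (runs_ticks 1)) => // *; apply: runs_ret. Qed.

Lemma runs_array_set A (x0 : A) a i x :
  runs (array_set x0 a i x) 1 (fun r => r = set_nth x0 a i x).
Proof. by rewrite /array_set; apply: (runs_bind (runs_ticks 1)) => // *; apply: runs_ret. Qed.

Lemma runs_array_length A (a : seq A) :
  runs (array_length a) 1 (fun r => r = size a).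
Proof. by rewrite /array_length; apply: (runs_bind (runs_ticks 1)) => // *; apply: runs_ret. Qed.

Lemma runs_new_array A n (x : A) : runs (new_array n x) n (fun r => r = nseq n x).
Proof. by rewrite /new_array; apply: (runs_bind (runs_ticks n)) => // *; apply: runs_ret. Qed.

Lemma runs_numbers_below n : runs (numbers_below n) n (fun r => r = iota 0 n).
Proof. by rewrite /numbers_below; apply: (runs_bind (runs_ticks n)) => // *; apply: runs_ret. Qed.

(* The first argument of [Inv] is the part of the list that remains to be treated. *)
Lemma runs_for_each (A : eqType) B N k (f : B -> A -> prog B)
    (Inv : seq A -> B -> Prop) l b :
  0 < N -> size l <= N ->
  (forall x r c, x \in l -> Inv (x :: r) c -> runs (f c x) k (Inv r)) ->
  Inv l b -> runs (for_each f b l) (k.+2 * N) (Inv [::]).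
Proof.
move=> N_gt0 le_lN Hf Ib.
(* The exact bound: one test per element besides the body, and a last test on the empty list, which
   [0 < N] lets the second extra [N] absorb. *)
apply: (@runs_weaken _ _ (k.+1 * size l).+1 _ (Inv [::])) => //; last by nia.
elim: l b Hf Ib {le_lN} => [|x l IHl] b Hf Ib /=.
  by apply: (runs_bind (runs_ticks 1)) => // *; apply: runs_ret.
apply: (runs_bind (runs_ticks 1)) => // _ _.
apply: (runs_bind (Hf _ _ _ (mem_head _ _) Ib)) => [|c Ic]; first by lia.
apply: runs_weaken (IHl c _ Ic) _ _ => //; last by nia.
by move=> y r d yl; apply: Hf; rewrite in_cons yl orbT.
Qed.

Lemma runs_find_first (A : eqType) N k (p : A -> prog bool)
    (R : A -> bool -> Prop) l :
  0 < N -> size l <= N -> (forall x, x \in l -> runs (p x) k (R x)) ->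
  runs (find_first p l) (k.+2 * N) (fun o => match o with
    | Some x => x \in l /\ R x true
    | None => forall x, x \in l -> R x false end).
Proof.
move=> N_gt0 le_lN Hp.
apply: (@runs_weaken _ _ (k.+1 * size l).+1 _ _ _ _ _ (fun _ => id)); last by nia.
elim: l Hp {le_lN} => [|x l IHl] Hp /=.
  by apply: (runs_bind (runs_ticks 1)) => // *; apply: runs_ret.
apply: (runs_bind (runs_ticks 1)) => // _ _.
apply: (runs_bind (Hp _ (mem_head _ _))) => [|[] Rx]; first by lia.
  by apply: runs_ret; rewrite mem_head.
apply: runs_weaken (IHl _) _ _ => [y yl||[y [yl Ry]|Rl]].
- by apply: Hp; rewrite in_cons yl orbT.
- by nia.
- by rewrite in_cons yl orbT.
- by move=> y; rewrite in_cons => /predU1P[->|/Rl].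
Qed.

(** One unit per element more than in [find_first], since a kept element is pushed again. *)
Lemma runs_keep (A : eqType) N k (p : A -> prog bool) (P : pred A) l :
  0 < N -> size l <= N ->
  (forall x, x \in l -> runs (p x) k (fun b => b = P x)) ->
  runs (keep p l) (k.+3 * N) (fun r => r = [seq x <- l | P x]).
Proof.
move=> N_gt0 le_lN Hp.
apply: (@runs_weaken _ _ (k.+2 * size l).+1 _ _ _ _ _ (fun _ => id)); last by nia.
elim: l Hp {le_lN} => [|x l IHl] Hp /=.
  by apply: (runs_bind (runs_ticks 1)) => // *; apply: runs_ret.
apply: (runs_bind (runs_ticks 1)) => // _ _.
apply: (runs_bind (Hp _ (mem_head _ _))) => [|_ ->]; first by lia.
apply: (runs_bind (IHl _)) => [y yl||_ ->]; [|by nia|].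
  by apply: Hp; rewrite in_cons yl orbT.
case: (P x); last exact: runs_ret.
by apply: runs_weaken (runs_push _ _) _ (fun _ => id); nia.
Qed.

(** * Lists, arrays and states *)

(** The device that controls lengths: distinct numbers less than [M] are at most [M] in number, and
    insertion after a membership test preserves this. *)
Definition below M (l : seq nat) : bool := uniq l && all (gtn M) l.

Lemma below_uniq M l : below M l -> uniq l.
Proof. by case/andP. Qed.

Lemma below_lt M l x : below M l -> x \in l -> x < M.
Proof. by case/andP=> _ /allP; apply. Qed.

Lemma below_size M l : below M l -> size l <= M.
Proof.
move=> bl; rewrite -[M in _ <= M](size_iota 0); apply: uniq_leq_size.
  exact: below_uniq bl.
by move=> x /(below_lt bl); rewrite mem_iota.
Qed.

Lemma below_filter M (P : pred nat) l : below M l -> below M (filter P l).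
Proof.
case/andP=> ul al; rewrite /below filter_uniq //=; apply/allP=> x.
by rewrite mem_filter => /andP[_ /(allP al)].
Qed.

Lemma below_cons M x l : below M l -> x < M -> x \notin l -> below M (x :: l).
Proof. by rewrite /below /= => /andP[-> ->] -> ->. Qed.

Lemma below_iota M : below M (iota 0 M).
Proof. by rewrite /below iota_uniq; apply/allP=> x; rewrite mem_iota. Qed.

(** The index [v] may be unrestricted because the default list outside the array is empty. The exact
    size ensures that a write at [v < M] does not extend the array. *)
Definition lists_below M (a : lists) : Prop :=
  size a = M /\ forall v, below M (nth [::] a v).

Lemma lists_below_set M a v l :
  lists_below M a -> v < M -> below M l -> lists_below M (set_nth [::] a v l).
Proof.
case=> sa ba ltv bl; split=> [|w]; first by rewrite size_set_nth sa; apply/maxn_idPr.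
by rewrite nth_set_nth /=; case: eqP.
Qed.

Lemma lists_below_nseq M : lists_below M (nseq M [::]).
Proof. by split=> [|v]; rewrite ?size_nseq // nth_nseq if_same. Qed.

Lemma mem_remove (x : nat) l y : (y \in [seq z <- l | z != x]) = (y != x) && (y \in l).
Proof. by rewrite mem_filter. Qed.

(** The measure of progress: a step going back to Step 3 leaves a sublist of the vertices that
    misses a known one. *)
Lemma size_strict_subset (s1 s2 : seq nat) x :
  uniq s1 -> {subset s1 <= s2} -> x \in s2 -> x \notin s1 -> size s1 < size s2.
Proof.
move=> u1 s12 x2 x1; apply: (@uniq_leq_size _ (x :: s1)); first by rewrite /= x1.
by move=> y; rewrite in_cons => /predU1P[->|/s12].
Qed.

Lemma other_partK : involutive other_part.
Proof.
move=> c; rewrite /other_part; case: (boolP (odd c)) => [|/negPf] oc; last by rewrite /= oc.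
by case: c oc => //= c /negPf->.
Qed.

Lemma other_part_neq c : other_part c != c.
Proof. by rewrite /other_part; case: ifP => oc; lia. Qed.

Lemma other_part_eq a b : (other_part a == b) = (a == other_part b).
Proof. by rewrite (can2_eq other_partK other_partK). Qed.

(** The pairs are 2i and 2i+1, so an even bound never separates a pair. *)
Lemma other_part_lt c r : c < r.*2 -> other_part c < r.*2.
Proof. by rewrite /other_part; case: ifP => oc; lia. Qed.

(** * Cost of the operations on vertex lists and adjacency lists *)

Section Lists.
Variable N : nat.
Hypothesis N_gt0 : 0 < N.

Lemma runs_list_mem x l : size l <= N ->
  runs (list_mem x l) (2 * N) (fun b => b = (x \in l)).
Proof.
move=> le_lN; apply: (runs_bind (runs_find_first (k := 0)
    (R := fun y b => b = (y == x)) N_gt0 le_lN _)) => [y _||o] //.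
  exact: runs_ret.
case: o => [y [yl /esym/eqP <-]|yl]; apply: runs_ret => /=; first by rewrite yl.
by apply/esym/negP=> xl; have := yl x xl; rewrite eqxx.
Qed.

Lemma runs_list_remove x l : size l <= N ->
  runs (list_remove x l) (3 * N) (fun r => r = [seq y <- l | y != x]).
Proof. by move=> le_lN; apply: (@runs_keep _ N 0) => // y _; apply: runs_ret. Qed.

Lemma runs_list_insert x l : size l <= N ->
  runs (list_insert x l) (3 * N) (fun r => r = if x \in l then l else x :: l).
Proof.
move=> le_lN; apply: (runs_bind (runs_list_mem _ le_lN)) => [|_ ->]; first lia.
case: (x \in l); first exact: runs_ret.
by apply: runs_weaken (runs_push _ _) _ (fun _ => id); lia.
Qed.

Lemma runs_list_union M l1 l2 : M <= N -> below M l1 -> below M l2 ->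
  runs (list_union l1 l2) ((3 * N).+2 * N) (below M).
Proof.
move=> leMN b1 b2; apply: (@runs_for_each _ _ N (3 * N) _ (fun=> below M)) => //.
  exact: leq_trans (below_size b2) leMN.
move=> x _ l xl2 bl.
apply: runs_weaken (runs_list_insert x (leq_trans (below_size bl) leMN)) _ _ => // _ ->.
by case: ifPn => // xl; apply: below_cons => //; apply: below_lt xl2.
Qed.

Lemma runs_count_cells A (l : seq A) : size l <= N ->
  runs (count_cells l) (2 * N) (fun c => c = size l).
Proof.
rewrite /count_cells => le_lN.
apply: (@runs_weaken _ _ (size l).+1 _ (fun c => c = 0 + size l)) => //; last lia.
elim: l 0 {le_lN} => [|x l IHl] c /=.
  by apply: (runs_bind (runs_ticks 1)) => // *; apply: runs_ret; rewrite addn0.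
apply: (runs_bind (runs_ticks 1)) => // _ _.
apply: (@runs_bind _ _ _ _ 0 _ (eq c.+1)) => //; first exact: runs_ret.
by move=> _ <-; apply: runs_weaken (IHl _) _ _ => [|_ ->]; lia.
Qed.

Lemma runs_is_empty A (l : seq A) : runs (is_empty l) 1 (fun b => b = nilp l).
Proof. by apply: (runs_bind (runs_pop l)) => // _ ->; apply: runs_ret; case: l. Qed.

Lemma runs_get_list a v : runs (get_list a v) 1 (fun l => l = nth [::] a v).
Proof. exact: runs_array_get. Qed.

Lemma runs_push_at a v w :
  runs (push_at a v w) 3 (fun r => r = set_nth [::] a v (w :: nth [::] a v)).
Proof.
apply: (runs_bind (runs_get_list a v)) => // _ ->.
by apply: (runs_bind (runs_push _ _)) => // _ ->; apply: runs_array_set.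
Qed.

Variable M : nat.
Hypothesis leMN : M <= N.

Lemma lists_below_size a v : lists_below M a -> size (nth [::] a v) <= N.
Proof. by case=> _ ba; apply: leq_trans (below_size (ba v)) leMN. Qed.

Lemma runs_adjacent a v w : lists_below M a ->
  runs (adjacent a v w) (3 * N) (fun b => b = (w \in nth [::] a v)).
Proof.
move=> ba; apply: (runs_bind (runs_get_list a v)) => [|_ ->]; first lia.
by apply: runs_weaken (runs_list_mem _ (lists_below_size _ ba)) _ _ => //; lia.
Qed.

Lemma runs_insert_at a v w : lists_below M a -> v < M -> w < M ->
  runs (insert_at a v w) (5 * N) (fun r => lists_below M r /\ forall x y,
    (y \in nth [::] r x) = (y \in nth [::] a x) || ((x == v) && (y == w))).
Proof.
move=> ba ltv ltw; apply: (runs_bind (runs_get_list a v)) => [|_ ->]; first lia.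
apply: (runs_bind (runs_list_insert _ (lists_below_size _ ba))) => [|_ ->]; first lia.
apply: runs_weaken (runs_array_set _ _ _ _) _ _ => [|_ ->]; first lia.
have bv := ba.2 v; split.
  by apply: lists_below_set => //; case: ifPn => // wv; apply: below_cons.
move=> x y; rewrite nth_set_nth /=; have [->|_] := eqVneq x v; last by rewrite orbF.
case: ifP => wv /=; last by rewrite in_cons orbC.
by have [->|_] := eqVneq y w; rewrite ?wv ?orbF.
Qed.

Lemma runs_remove_at a v w : lists_below M a -> v < M ->
  runs (remove_at a v w) (5 * N) (fun r => lists_below M r /\ forall x y,
    (y \in nth [::] r x) = (y \in nth [::] a x) && ~~ ((x == v) && (y == w))).
Proof.
move=> ba ltv; apply: (runs_bind (runs_get_list a v)) => [|_ ->]; first lia.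
apply: (runs_bind (runs_list_remove _ (lists_below_size _ ba))) => [|_ ->]; first lia.
apply: runs_weaken (runs_array_set _ _ _ _) _ _ => [|_ ->]; first lia.
have bv := ba.2 v; split.
  by apply: lists_below_set => //; apply: below_filter.
move=> x y; rewrite nth_set_nth /=; have [->|_] := eqVneq x v; last by rewrite andbT.
by rewrite mem_remove andbC.
Qed.

End Lists.

(* [vs] and [ng] are the vertices and the negative adjacency lists of a graph. *)
Record graph M (vs : seq nat) (ng : lists) : Prop := Graph {
  graph_verts : below M vs;
  graph_lists : lists_below M ng;
  graph_sym : forall x y, y \in nth [::] ng x -> x \in nth [::] ng y;
  graph_closed : forall x y, y \in nth [::] ng x -> y \in vs
}.

(* [core] is preserved by every single identification; [paired] holds between steps. *)
Record core M N (st : state) : Prop := Core {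
  core_matched : forall x, x < M -> nth [::] (pos_adj st) x = [:: other_part x];
  core_graph : graph M (verts st) (neg_adj st);
  core_forbidden : below M (forbidden_B st);
  core_disjoint : forall x, x \in cover_S st -> x \notin verts st;
  core_size : size (cover_S st) + size (verts st) <= N;
  core_groups : \sum_(x <- verts st) size (nth [::] (groups st) x) <= N;
  core_cover_groups :
    forall x, x \in cover_S st -> size (nth [::] (groups st) x) <= N
}.

Record paired (st : state) : Prop := Paired {
  paired_verts : forall x, x \in verts st -> other_part x \in verts st;
  paired_edges : forall x, other_part x \notin nth [::] (neg_adj st) x
}.

(** * Deletion, selection and identification of vertices *)

Section State.
Variables M N : nat.
Hypotheses (N_gt0 : 0 < N) (leMN : M <= N).

Lemma runs_bar st x :
  (forall x, x < M -> nth [::] (pos_adj st) x = [:: other_part x]) -> x < M ->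
  runs (bar st x) 2 (fun y => y = other_part x).
Proof.
move=> mst ltx; apply: (runs_bind (runs_get_list _ _)) => // _ ->.
by rewrite mst //; apply: (runs_bind (runs_pop _)) => // _ -> /=; apply: runs_ret.
Qed.

(** By symmetry of the lists, the vertices that list [x] are the entries of the list of [x], so
    removing [x] from those lists removes it everywhere. *)
Lemma runs_delete_vertex st x :
  graph M (verts st) (neg_adj st) -> x \in verts st ->
  runs (delete_vertex st x) (12 * N * N) (fun st' => exists ng,
    [/\ st' = with_verts (with_neg st ng) [seq y <- verts st | y != x],
        graph M [seq y <- verts st | y != x] ng
      & forall y z, z \in nth [::] ng y -> z \in nth [::] (neg_adj st) y]).
Proof.
move=> [bv bn sym cl] xv; have ltx := below_lt bv xv.
set a := neg_adj st.
apply: (runs_bind (runs_get_list _ _)) => [|_ ->]; first by nia.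
rewrite -/a.
(* No entry is added, no entry other than [x] is lost, and a neighbor already treated has ceased to
   list [x]. *)
apply: (runs_bind (runs_for_each (k := 5 * N) (N := N)
  (Inv := fun r ng => [/\ lists_below M ng,
    forall y z, z \in nth [::] ng y -> z \in nth [::] a y,
    forall y z, z \in nth [::] a y -> z != x -> z \in nth [::] ng y
  & forall u, u \in nth [::] a x -> u \notin r -> x \notin nth [::] ng u])
  _ _ _ _)) => //.
- exact: lists_below_size bn.
- move=> u r ng ux [bng sub sup del].
  have ltu : u < M by apply: below_lt ux; case: bn.
  apply: runs_weaken (runs_remove_at _ leMN _ bng ltu) _ _ => // ng' [bng' E].
  split=> // [y z|y z zy zx|y yx yr]; rewrite E.
  + by case/andP=> /sub.
  + by rewrite sup //= (negPf zx) andbF.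
  + rewrite eqxx andbT; have [->|yu] := eqVneq y u; first by rewrite andbF.
    by rewrite (negPf (del y yx _)) // in_cons negb_or yu.
- by split=> // u ->.
- by nia.
move=> ng [bng sub sup del].
apply: (runs_bind (runs_array_set _ _ _ _)) => [|_ ->]; first by nia.
apply: (runs_bind (runs_list_remove N_gt0 _ (leq_trans (below_size bv) leMN))) => [|_ ->].
  by nia.
apply: runs_ret; exists (set_nth [::] ng x [::]).
have mem_ng y z : (z \in nth [::] (set_nth [::] ng x [::]) y) =
    [&& y != x, z != x & z \in nth [::] a y].
  rewrite nth_set_nth /=; have [//|yx /=] := eqVneq y x.
  have [->|zx] /= := eqVneq z x; last by apply/idP/idP => [/sub|/sup->].
  by apply/negP=> xy; have := del y (sym _ _ (sub _ _ xy)) isT; rewrite xy.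
split=> //; last by move=> y z; rewrite mem_ng => /and3P[].
split; [exact: below_filter|exact: lists_below_set| |] => y z; rewrite !mem_ng.
  by case/and3P=> -> -> /sym.
by case/and3P=> _ zx /cl zv; rewrite mem_remove zx.
Qed.

(** The vertex that enters S leaves the graph, so the sum of the two sizes does not grow. Its group
    was one term of the bounded total when it left, and that bound stays with it as a member of
    S. *)
Lemma runs_select st x : core M N st -> paired st -> x \in verts st ->
  runs (select st x) (40 * N * N) (fun st' =>
    [/\ core M N st', paired st' & size (verts st') < size (verts st)]).
Proof.
move=> [mst g bB dis siz sumg covg] [pv pe] xv.
have ltx := below_lt (graph_verts g) xv.
have bx := (graph_lists g).2 x.
apply: (runs_bind (runs_bar mst ltx)) => [|_ ->]; first by nia.
apply: (runs_bind (runs_push _ _)) => [|_ ->]; first by nia.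
apply: (runs_bind (runs_get_list _ _)) => [|_ ->]; first by nia.
apply: (runs_bind (runs_list_union N_gt0 leMN bB bx)) => [|b bb]; first by nia.
apply: (runs_bind (runs_delete_vertex (st := with_forbidden (with_cover st _) _) g xv))
  => [|_ [ng1 [-> g1 sub1]]]; first by nia.
set st1 := with_verts _ _.
apply: runs_weaken (@runs_delete_vertex st1 _ g1 _) _ _ => /=.
- by rewrite mem_remove other_part_neq pv.
- by nia.
move=> _ [ng2 [-> g2 sub2]].
set vs := [seq y <- _ | y != other_part x] in g2 *.
have mem_vs y : (y \in vs) = [&& y != other_part x, y != x & y \in verts st].
  by rewrite !mem_remove.
have lt_size : size vs < size (verts st).
  apply: (size_strict_subset (x := x)) => //; first exact: below_uniq (graph_verts g2).
    by move=> y; rewrite mem_vs => /and3P[].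
  by rewrite mem_vs eqxx andbF.
have le_sum (F : nat -> nat) P s : \sum_(y <- [seq y <- s | P y]) F y <= \sum_(y <- s) F y.
  by rewrite big_filter [leqRHS](bigID P) leq_addr.
split=> //; split=> //=.
- move=> y; rewrite in_cons mem_vs => /predU1P[->|/dis/negPf->]; last by rewrite !andbF.
  by rewrite eqxx andbF.
- by apply: leq_trans siz; rewrite addSnnS leq_add2l.
- by apply: leq_trans sumg; apply: leq_trans (le_sum _ _ _) (le_sum _ _ _).
- move=> y; rewrite in_cons => /predU1P[->|/covg//].
  by apply: leq_trans sumg; rewrite (big_rem x) //= leq_addr.
- move=> y; rewrite !mem_vs => /and3P[yx' yx yv].
  by rewrite !other_part_eq other_partK yx yx' pv.
- by move=> y; apply/negP=> /sub2/sub1; apply/negP.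
Qed.

Lemma runs_select_bar st x : core M N st -> paired st -> x \in verts st ->
  runs (select_bar st x) (42 * N * N) (fun st' =>
    [/\ core M N st', paired st' & size (verts st') < size (verts st)]).
Proof.
move=> cst pst xv; have ltx := below_lt (graph_verts (core_graph cst)) xv.
apply: (runs_bind (runs_bar (core_matched cst) ltx)) => [|_ ->]; first by nia.
by apply: runs_weaken (runs_select cst pst (paired_verts pst xv)) _ _ => //; nia.
Qed.

(** The total size of the groups is unchanged: the group of [z] passes to [w], and [z] leaves the
    graph. Groups of members of S are untouched, since [w] is a vertex of the graph and hence not in
    S. Every new edge touches [w]; the last clause records this in order to locate the mate edges
    that an identification may create. *)
Lemma runs_identify st w z : core M N st -> w \in verts st -> z \in verts st ->
  z != w ->
  runs (identify w st z) (40 * N * N) (fun st' =>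
    [/\ core M N st',
        verts st' = [seq y <- verts st | y != z]
      & forall x y, x != w -> y != w -> y \in nth [::] (neg_adj st') x ->
          y \in nth [::] (neg_adj st) x]).
Proof.
move=> [mst [bv bn sym cl] bB dis siz sumg covg] wv zv zw.
have ltw := below_lt bv wv; have ltz := below_lt bv zv.
set a := neg_adj st in bn sym cl *.
(* Where a neighbor [u] of [z] ends up; a loop at [z] becomes a loop at [w]. As [f u] is never [z],
   no insertion brings [z] back. *)
pose f u := if u == z then w else u.
have fz u : f u != z by rewrite /f; have [_|//] := eqVneq u z; rewrite eq_sym.
apply: (runs_bind (runs_get_list _ _)) => [|_ ->]; first by nia.
rewrite -/a.
(* An entry is old or comes from redirecting an edge at [z], in one of its two directions; nothing
   but [z] is lost; a treated neighbor no longer lists [z] and is joined to [w] both ways. *)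
apply: (runs_bind (runs_for_each (k := 15 * N) (N := N)
  (Inv := fun r ng => [/\ lists_below M ng,
    forall x y, y \in nth [::] ng x -> [\/ y \in nth [::] a x,
      (exists u, [/\ u \in nth [::] a z, x = f u & y = w]) |
      (exists u, [/\ u \in nth [::] a z, x = w & y = f u])],
    forall x y, y \in nth [::] a x -> y != z -> y \in nth [::] ng x
  & forall u, u \in nth [::] a z -> u \notin r -> [/\ z \notin nth [::] ng u,
      w \in nth [::] ng (f u) & f u \in nth [::] ng w]])
  _ _ _ _)) => //.
- exact: lists_below_size bn.
- move=> u r ng uz [bng snd cmp fin].
  have ltu : u < M by apply: below_lt uz; case: bn.
  have ltfu : f u < M by rewrite /f; case: ifP.
  apply: (runs_bind (runs_remove_at _ leMN _ bng ltu)) => // [|ng1 [b1 E1]]; first by lia.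
  apply: (runs_bind (runs_insert_at _ leMN b1 ltfu ltw)) => // [|ng2 [b2 E2]]; first by lia.
  apply: runs_weaken (runs_insert_at _ leMN b2 ltw ltfu) _ _ => // [|ng3 [b3 E3]]; first by lia.
  have E x y : (y \in nth [::] ng3 x) =
      [|| (y \in nth [::] ng x) && ~~ ((x == u) && (y == z)),
          (x == f u) && (y == w) | (x == w) && (y == f u)].
    by rewrite E3 E2 E1 -orbA.
  split=> // [x y|x y yx yz|v vz vr].
  + rewrite E => /or3P[/andP[/snd//]|/andP[/eqP-> /eqP->]|/andP[/eqP-> /eqP->]].
      by apply: Or32; exists u.
    by apply: Or33; exists u.
  + by rewrite E cmp //= (negPf yz) andbF.
  + have wz : (w == z) = false by rewrite eq_sym; apply: negPf.
    have zfu : (z == f u) = false by rewrite eq_sym; apply: negPf.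
    have [->|vu] := eqVneq v u.
      by split; rewrite E !eqxx /= ?(negPf zw) ?zfu ?andbF ?orbT.
    have [|h1 h2 h3] := fin v vz; first by rewrite in_cons negb_or vu.
    by split; rewrite E ?h2 ?h3 ?(negPf h1) ?(negPf zw) ?zfu ?(negPf (fz v)) ?wz ?andbF.
- by split=> // [x y ->|u ->//]; apply: Or31.
- by nia.
move=> ng [bng snd cmp fin].
apply: (runs_bind (runs_array_set _ _ _ _)) => [|_ ->]; first by nia.
apply: (runs_bind (runs_list_remove N_gt0 _ (leq_trans (below_size bv) leMN))) => [|_ ->].
  by nia.
apply: (runs_bind (runs_get_list _ _)) => [|_ ->]; first by nia.
have sum_split (F : nat -> nat) : \sum_(x <- verts st) F x =
    F z + \sum_(x <- [seq y <- verts st | y != z]) F x.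
  by rewrite (bigD1_seq z) ?(below_uniq bv) //= big_filter.
have le_gN : size (nth [::] (groups st) z) <= N.
  by move: sumg; rewrite sum_split; lia.
set g := nth [::] (groups st) z in le_gN *.
(* The group of [w] grows exactly as the part of [g] still to be moved shrinks; all other groups
   keep their length. *)
apply: (runs_bind (runs_for_each (k := 3) (N := N)
  (Inv := fun r gr => forall x, size (nth [::] gr x) + (x == w) * size r =
    size (nth [::] (groups st) x) + (x == w) * size g) _ _ _ _)) => //.
- move=> v r gr vg Hgr; apply: runs_weaken (runs_push_at _ _ _) _ _ => // _ -> x.
  by rewrite -Hgr nth_set_nth /=; case: (x =P w) => [->|] //=; lia.
- by nia.
move=> gr Hgr; apply: runs_ret.
have mem_ng x y : (y \in nth [::] (set_nth [::] ng z [::]) x) =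
    (x != z) && (y \in nth [::] ng x).
  by rewrite nth_set_nth /=; case: eqVneq.
(* No list but possibly the one of [z], now emptied, can hold [z]: by symmetry an old entry would
   sit in the list of a treated neighbor, and the inserted entries differ from [z]. *)
have in_nz x y : x != z -> y \in nth [::] ng x -> y != z.
  move=> xz yx; apply/eqP=> yz; rewrite yz in yx => {y yz}.
  case: (snd _ _ yx) => [zx|[u [uz xfu zw']]|[u [uz _ zfu]]].
  - by have [/negP] := fin x (sym _ _ zx) isT.
  - by rewrite zw' eqxx in zw.
  - by have := fz u; rewrite -zfu eqxx.
split=> //; last first.
  move=> x y xw yw; rewrite mem_ng => /andP[_] /snd [//|[u [_ _ yw']]|[u [_ xw' _]]].
    by rewrite yw' eqxx in yw.
  by rewrite xw' eqxx in xw.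
split=> //=.
- split; [exact: below_filter|exact: lists_below_set| |] => x y; rewrite mem_ng.
  + case/andP=> xz yx; rewrite mem_ng (in_nz x y) //=.
    case: (snd _ _ yx) => [/sym xy|[u [uz -> ->]]|[u [uz -> ->]]]; first exact: cmp.
      by have [] := fin u uz isT.
    by have [] := fin u uz isT.
  + case/andP=> xz yx; rewrite mem_remove (in_nz x y) //=.
    case: (snd _ _ yx) => [/cl //|[u [uz _ ->]]|[u [uz _ ->]]] //.
    by rewrite /f; case: ifP => // _; apply: cl uz.
- by move=> x /dis/negPf xv; rewrite mem_remove xv andbF.
- by apply: leq_trans siz; rewrite leq_add2l size_filter count_size.
- apply: leq_trans sumg; rewrite sum_split -/g.
  have wv' : w \in [seq y <- verts st | y != z] by rewrite mem_remove eq_sym zw.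
  have uv' : uniq [seq y <- verts st | y != z] by rewrite filter_uniq ?(below_uniq bv).
  rewrite !(bigD1_seq w wv' uv') /=.
  have := Hgr w; rewrite eqxx /= muln0 addn0 mul1n => ->.
  rewrite addnC addnA [leqRHS]addnC [X in _ <= X + _]addnC !leq_add2r.
  by apply: leq_sum => x /negPf xw; have := Hgr x; rewrite xw !addn0 => ->.
- move=> x xS; have xw : x != w by apply: contraTneq wv => <-; apply: dis.
  by have := Hgr x; rewrite (negPf xw) /= !mul0n !addn0 => ->; apply: covg.
Qed.
End State.

(** * Steps 3 to 12 *)

(** The arc closing the cycle goes to [w] strictly below the top [v], so the path contains both.
    Each stack entry costs three units: a pop, a push and the unit of the loop. *)
Lemma runs_path_down_to N w v l (stack : seq (nat * seq nat)) :
  size stack < N -> w != v -> w \in map fst stack ->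
  uniq (v :: map fst stack) ->
  runs (path_down_to w ((v, l) :: stack)) (3 * N + 1) (fun p =>
    [/\ uniq p, {subset p <= v :: map fst stack} & 1 < size p]).
Proof.
move=> lt_sN wv ws us; set s0 := (v, l) :: stack.
apply: (@runs_weaken _ _ (3 * size s0 + 1)) (_ : runs _ _ _) _ (fun _ => id); last first.
  by rewrite /s0 /=; lia.
rewrite /path_down_to.
(* The last clause says that the path is empty at the start alone; it excludes stopping at the top
   entry, which is [v] and not [w]. *)
pose Inv (s : seq (nat * seq nat) * seq nat) :=
  [/\ uniq (s.2 ++ map fst s.1), {subset s.2 ++ map fst s.1 <= map fst s0},
      w \in map fst s.1 & s.2 = [::] -> s.1 = s0].
apply: (runs_loop (Inv := Inv) (phi := fun s => 3 * size s.1 + 1)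
  _ (a := (s0, [::]))) => [[s p]|]; last first.
  by split=> //=; rewrite in_cons ws orbT.
case=> /= usp sub wsp p0; case: s => [//|[u l'] s] /= in usp sub wsp p0 *.
have perm_up : perm_eq (p ++ u :: map fst s) ((u :: p) ++ map fst s).
  by rewrite -cat1s perm_catCA.
rewrite (perm_uniq perm_up) in usp.
have {}sub : {subset (u :: p) ++ map fst s <= v :: map fst stack}.
  by move=> x; rewrite -(perm_mem perm_up); apply: sub.
exists 2; first by rewrite /=; lia.
apply: (runs_bind (runs_pop _)) => // _ -> /=.
apply: (runs_bind (runs_push _ _)) => // _ ->.
have [uw|uw] := eqVneq u w; apply: runs_ret; last first.
  split; last by rewrite /=; lia.
  by split=> //=; move: wsp; rewrite in_cons eq_sym (negPf uw).
split.
- by move: usp; rewrite cat_uniq => /and3P[].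
- by move=> x xp; apply: sub; rewrite mem_cat xp.
- by case: p p0 {usp sub perm_up} => [/(_ erefl) [uv]|//]; rewrite -uw uv eqxx in wv.
Qed.

(* As every vertex has a successor, the vertex on top of the stack has never been
   explored before, so that the search does not finish a vertex. *)
Lemma runs_find_cycle M N F vs :
  M <= N -> size F = M -> below M vs -> 0 < size vs ->
  (forall v, v \in vs -> nth [::] F v != [::]) ->
  (forall v w, v \in vs -> w \in nth [::] F v -> w \in vs /\ w != v) ->
  runs (find_cycle F vs) (30 * N + 30) (fun o => exists c,
    [/\ o = Some c, uniq c, {subset c <= vs} & 1 < size c]).
Proof.
move=> leMN sF bvs vs0 F0 Fvs.
have size_stack (s : seq nat) : uniq s -> {subset s <= vs} -> size s <= N.
  move=> us sub; apply: leq_trans leMN; apply: leq_trans (below_size bvs).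
  exact: uniq_leq_size.
apply: (runs_bind (runs_array_length _)) => [|_ ->]; first by lia.
apply: (runs_bind (runs_new_array _ _)) => [|_ ->]; first by rewrite sF; lia.
pose Inv (s : (seq nat * seq (nat * seq nat)) * seq mark) :=
  let '((roots, stack), marks) := s in
  let vis := map fst stack in
  [/\ uniq vis, {subset vis <= vs},
      forall v, v \in vs -> nth Unvisited marks v = if v \in vis then OnStack else Unvisited
    & if stack is (v, l) :: _ then l = nth [::] F v else roots = vs].
(* Each vertex not yet on the stack is worth 10, enough for the visit that puts it there; the
   reserve [8 * N + 8] pays the final iteration, which reads the cycle off the stack. *)
pose phi (s : (seq nat * seq (nat * seq nat)) * seq mark) :=
  8 * N + 8 + 10 * (N.+1 - size s.1.2).
apply: (@runs_weaken _ _ (phi ((vs, [::]), nseq (size F) Unvisited))) (_ : runs _ _ _) _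
  (fun _ => id); last by rewrite /phi sF /=; lia.
apply: (runs_loop (Inv := Inv) (phi := phi)) => [[[roots stack] marks]|]; last first.
  by split=> // v _; rewrite nth_nseq if_same.
have visit v st : v \in vs -> v \notin map fst st -> uniq (map fst st) ->
    {subset map fst st <= vs} ->
    (forall u, u \in vs -> nth Unvisited marks u =
      if u \in map fst st then OnStack else Unvisited) ->
    forall r, Inv ((r, (v, nth [::] F v) :: st), set_nth Unvisited marks v OnStack) /\
      size st < N.
  move=> vvs vst ust sub mst r; split; last first.
    rewrite -(size_map fst); apply: (size_stack (v :: map fst st)) => /=.
      by rewrite vst.
    by move=> u; rewrite in_cons => /predU1P[->|/sub].
  split=> //=; first by rewrite vst.
    by move=> u; rewrite in_cons => /predU1P[->|/sub].
  move=> u uvs; rewrite nth_set_nth /= in_cons.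
  by have [->|uv] := eqVneq u v; last exact: mst.
case=> ust sub mst; case: stack => [|[v l] stack] in ust sub mst *.
  move=> ->; exists 6; first by rewrite /phi /=; lia.
  apply: (runs_bind (runs_pop _)) => // _ -> /=.
  apply: (runs_bind (runs_pop _)) => // _ -> /=.
  case: vs vs0 @Inv sub mst visit {bvs F0 Fvs size_stack} => // v vs _ Inv sub mst visit.
  apply: (runs_bind (runs_array_get _ _ _)) => // _ ->.
  have vvs : v \in v :: vs by rewrite mem_head.
  rewrite mst //=.
  apply: (runs_bind (runs_array_set _ _ _ _)) => // _ ->.
  apply: (runs_bind (runs_get_list _ _)) => // _ ->.
  apply: (runs_bind (runs_push _ _)) => // _ ->.
  apply: runs_ret; have [Inv' ltN] := visit v [::] vvs isT isT sub mst vs.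
  by split=> //; rewrite /phi /= in ltN *; lia.
move=> El; have vvs : v \in vs by apply: sub; rewrite mem_head.
have le_sN : size stack < N.
  by rewrite -(size_map fst); apply: (size_stack _ ust sub).
rewrite /= in ust sub mst.
have := F0 v vvs; have := Fvs v ^~ vvs; rewrite -El.
case: l El => [//|w l] El Fw _.
have [wvs wv] := Fw w (mem_head _ _).
have [wst|wst] := boolP (w \in v :: map fst stack).
  have ws : w \in map fst stack by move: wst; rewrite in_cons (negPf wv).
  exists (8 * N + 7); first by rewrite /phi /=; lia.
  apply: (runs_bind (runs_pop _)) => [|_ ->]; first by lia.
  apply: (runs_bind (runs_pop _)) => [|_ ->]; first by lia.
  apply: (runs_bind (runs_array_get _ _ _)) => [|_ ->]; first by lia.
  rewrite (mst w wvs) wst.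
  apply: (runs_bind (runs_path_down_to _ le_sN wv ws ust)) => [|p [up subp szp]].
    by lia.
  by apply: runs_ret; exists p; split=> // x /subp; apply: sub.
exists 7; first by rewrite /phi /=; lia.
apply: (runs_bind (runs_pop _)) => // _ ->.
apply: (runs_bind (runs_pop _)) => // _ ->.
apply: (runs_bind (runs_array_get _ _ _)) => // _ ->.
rewrite (mst w wvs) (negPf wst).
apply: (runs_bind (runs_push _ _)) => // _ ->.
apply: (runs_bind (runs_array_set _ _ _ _)) => // _ ->.
apply: (runs_bind (runs_get_list _ _)) => // _ ->.
apply: (runs_bind (runs_push _ _)) => // _ ->.
apply: runs_ret; have [Inv' ltN] := visit w ((v, l) :: stack) wvs wst ust sub mst roots.
by split=> //; rewrite /phi /= in ltN *; lia.
Qed.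

(** * Cost and progress of one round *)

Section Steps.
Variables M N : nat.
Hypotheses (N_gt0 : 0 < N) (leMN : M <= N).

(** These inequalities let [lia], for which the powers of [N] are atoms, compare costs of different
    degrees. *)
Let sqr_ge : N <= N * N. Proof. by nia. Qed.
Let cube_ge : N * N <= N * N * N. Proof. by nia. Qed.

Definition progress (st : state) (r : outcome) : Prop :=
  if r is inl st' then
    [/\ core M N st', paired st' & size (verts st') < size (verts st)]
  else True.

Lemma verts_size st : core M N st -> size (verts st) <= N.
Proof. by case=> _ [bv _ _ _] *; apply: leq_trans (below_size bv) leMN. Qed.

Lemma neg_size st x : core M N st -> size (nth [::] (neg_adj st) x) <= N.
Proof. by case=> _ [_ bn _ _] *; apply: lists_below_size leMN _ _ bn. Qed.

Lemma verts_lt st x : core M N st -> x \in verts st -> x < M.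
Proof. by case=> _ [bv _ _ _] *; apply: below_lt bv _. Qed.

Lemma neg_verts st x y : core M N st -> y \in nth [::] (neg_adj st) x -> y \in verts st.
Proof. by case=> _ [_ _ _ cl] *; apply: cl; eassumption. Qed.

Lemma runs_bar_verts st x : core M N st -> x \in verts st ->
  runs (bar st x) 2 (fun y => y = other_part x).
Proof. by move=> cst xv; apply: runs_bar (core_matched cst) (verts_lt cst xv). Qed.

Lemma runs_identify_all st w l : core M N st -> uniq (w :: l) ->
  {subset w :: l <= verts st} ->
  runs (for_each (identify w) st l) (42 * (N * N * N)) (fun st' =>
    [/\ core M N st',
        forall y, (y \in verts st') = (y \notin l) && (y \in verts st)
      & forall x y, x != w -> y != w -> y \in nth [::] (neg_adj st') x ->
          y \in nth [::] (neg_adj st) x]).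
Proof.
move=> cst /= /andP[wl ul] sub.
have le_lN : size l <= N.
  apply: leq_trans (verts_size cst); apply: uniq_leq_size => // x xl.
  by apply: sub; rewrite in_cons xl orbT.
pose Inv r st' := [/\ core M N st', uniq r,
  forall y, (y \in verts st') = ((y \notin l) || (y \in r)) && (y \in verts st)
  & forall x y, x != w -> y != w -> y \in nth [::] (neg_adj st') x ->
      y \in nth [::] (neg_adj st) x].
apply: runs_weaken (@runs_for_each _ _ N (40 * N * N) _ Inv _ _ N_gt0 le_lN _ _) _ _.
- move=> z r st' zl [cst' /= /andP[zr ur] ver snd].
  have wv : w \in verts st' by rewrite ver wl sub ?mem_head.
  have zv : z \in verts st' by rewrite ver mem_head orbT sub // in_cons zl orbT.
  have zw : z != w by apply: contraNneq wl => <-.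
  apply: runs_weaken (runs_identify N_gt0 leMN cst' wv zv zw) _ _ => // st2 [c2 v2 s2].
  split=> // [y|x y xw yw /(s2 x y xw yw)/snd]; last exact.
  rewrite v2 mem_remove ver in_cons; have [->|//] := eqVneq y z.
  by rewrite zl (negPf zr).
- by split=> // y; case: (y \in l).
- by lia.
- by move=> st' [cst' _ ver snd]; split=> // y; rewrite ver orbF.
Qed.

(** Identifications can break [paired]; here it is restored. In the earlier state [st0] no pair is
    joined by a negative edge, and every edge avoiding [x] and its mate was already present there,
    so the edge being deleted is the sole possible mate edge. *)
Lemma runs_delete_mate_edge st0 st x :
  paired st0 -> core M N st -> x \in verts st ->
  (forall y, y \in verts st -> other_part y \in verts st) ->
  (forall y z, y != x -> y != other_part x -> z != x -> z != other_part x ->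
     z \in nth [::] (neg_adj st) y -> z \in nth [::] (neg_adj st0) y) ->
  runs (delete_negative_edge st x (other_part x)) (10 * N) (fun st' =>
    [/\ core M N st', paired st' & verts st' = verts st]).
Proof.
move=> pst0 cst xv pv snd; have [mst [bv bn sym cl] bB dis siz sumg covg] := cst.
have x'v := pv x xv; set x' := other_part x in x'v snd *.
apply: (runs_bind (runs_remove_at N_gt0 leMN x' bn (verts_lt cst xv))) => [|ng1 [b1 E1]].
  by lia.
apply: (runs_bind (runs_remove_at N_gt0 leMN x b1 (verts_lt cst x'v))) => [|ng2 [b2 E2]].
  by lia.
have E y z : (z \in nth [::] ng2 y) = [&& z \in nth [::] (neg_adj st) y,
    ~~ ((y == x) && (z == x')) & ~~ ((y == x') && (z == x))].
  by rewrite E2 E1 -andbA.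
apply: runs_ret; split=> //.
  split=> //=; split=> // y z; rewrite !E => /and3P[]; last by move=> /cl.
  by move=> /sym -> n1 n2; rewrite ![(z == _) && _]andbC n2 n1.
split=> //= y; rewrite E.
have [->|yx] := eqVneq y x; first by rewrite !eqxx /= andbF.
have [->|yx'] := eqVneq y x'; first by rewrite /x' other_partK !eqxx !andbF.
rewrite andbT; apply/negP=> /snd; rewrite yx yx' !other_part_eq yx' /x'.
rewrite other_partK yx => /(_ isT isT isT isT).
by apply/negP; apply: paired_edges.
Qed.

Lemma runs_step12 st c : core M N st -> paired st ->
  uniq c -> {subset c <= verts st} -> 1 < size c ->
  runs (step12 st c) (200 * (N * N * N)) (progress st).
Proof.
move=> cst pst uc sub szc.
have le_cN : size c <= N by apply: leq_trans (verts_size cst); apply: uniq_leq_size.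
apply: (runs_bind (runs_for_each (k := 3) (N := N)
  (Inv := fun r c' => catrev (map other_part r) c' = rev (map other_part c))
  _ _ _ _)) => //.
- move=> x r c' xc E.
  apply: (runs_bind (runs_bar_verts cst (sub x xc))) => // _ ->.
  by apply: runs_weaken (runs_push _ _) _ _ => // _ ->.
- by lia.
move=> c' /= Ec'.
have mem_c' y : (y \in c') = (other_part y \in c).
  by rewrite Ec' mem_rev -{1}[y]other_partK mem_map //; apply: can_inj other_partK.
have uc' : uniq c' by rewrite Ec' rev_uniq map_inj_uniq //; apply: can_inj other_partK.
have le_c'N : size c' <= N by rewrite Ec' size_rev size_map.
apply: (runs_bind (runs_find_first (k := 2 * N) (N := N)
  (R := fun x b => b = (x \in c')) _ _ _)) => //.
- by move=> x _; apply: runs_list_mem.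
- by lia.
case=> [_ _|dis]; first exact: runs_ret.
apply: (runs_bind (runs_pop _)) => [|_ ->]; first by lia.
(* The cycle has a second vertex [x2]; being merged into [x], it is the vertex that witnesses
   progress. *)
case: c => [//|x [//|x2 rest0]] in uc sub szc le_cN Ec' mem_c' dis *.
set rest := x2 :: rest0 in uc sub szc le_cN Ec' mem_c' dis *.
have xv : x \in verts st by rewrite sub ?mem_head.
apply: (runs_bind (runs_bar_verts cst xv)) => [|_ ->]; first by lia.
apply: (runs_bind (runs_list_remove N_gt0 _ le_c'N)) => [|_ ->]; first by lia.
set y := other_part x; set rest' := [seq _ <- c' | _].
apply: (runs_bind (runs_identify_all cst uc sub)) => [|st1 [c1 v1 s1]]; first by lia.
have cc' u : u \in x :: rest -> u \notin c' by move=> /dis <-.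
have yc' : y \in c' by rewrite mem_c' /y other_partK mem_head.
have c'v u : u \in c' -> u \in verts st.
  by rewrite mem_c' => /sub/(paired_verts pst); rewrite other_partK.
(* Disjointness of the two cycles enters here: merging the first one removes no vertex of the
   second. *)
have sub1 : {subset y :: rest' <= verts st1}.
  move=> u; rewrite in_cons mem_remove => uy.
  have uc'' : u \in c' by case/predU1P: uy => [->|/andP[]].
  rewrite v1 c'v // andbT; apply: contraL uc'' => ur.
  by apply: cc'; rewrite in_cons ur orbT.
apply: (runs_bind (runs_identify_all c1 _ sub1)) => [||st2 [c2 v2 s2]].
- by rewrite /= mem_remove eqxx /= filter_uniq.
- by lia.
have mem2 u : (u \in verts st2) = [&& (u != y) ==> (u \notin c'), u \notin rest & u \in verts st].
  by rewrite v2 v1 mem_remove negb_and implybE.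
have xrest : x \notin rest by case/andP: uc.
have xc' : x \notin c' by apply: cc'; rewrite mem_head.
apply: (runs_bind (runs_delete_mate_edge pst c2 _ _ _)) => [||z u||st3 [c3 p3 v3]].
- by rewrite mem2 xc' xrest xv implybT.
- move=> u; rewrite !mem2 => /and3P[u1 u2 u3].
  rewrite (paired_verts pst u3) andbT mem_c' other_partK other_part_eq /y other_partK.
  have -> : (other_part u \notin rest).
    apply/negP=> our; have uc'' : u \in c' by rewrite mem_c' in_cons our orbT.
    move: u1; rewrite uc'' implybF negbK => /eqP uy.
    by move: our xrest; rewrite uy /y other_partK => ->.
  by rewrite andbT in_cons negb_or u2 andbT implybb.
- move=> zx zy ux uy /(s2 z u zy uy); exact: s1.
- by lia.
apply: runs_ret; split=> //; rewrite v3.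
apply: (size_strict_subset (x := x2)).
- exact: below_uniq (graph_verts (core_graph c2)).
- by move=> u; rewrite mem2 => /and3P[].
- by rewrite sub // !in_cons eqxx orbT.
- by rewrite mem2 mem_head andbF.
Qed.

Lemma runs_forcing_graph st : core M N st -> paired st ->
  (forall x, x \in verts st -> nth [::] (neg_adj st) x != [::]) ->
  runs (forcing_graph st) (20 * (N * N)) (fun F =>
    [/\ size F = M,
        forall x, x \in verts st -> nth [::] F x != [::]
      & forall x y, y \in nth [::] F x -> y \in verts st /\ y != x]).
Proof.
move=> cst pst ne; have [bn1 bn2] := graph_lists (core_graph cst).
have [pv pe] := pst.
apply: (runs_bind (runs_array_length _)) => [|_ ->]; first by lia.
rewrite bn1; apply: (runs_bind (runs_new_array _ _)) => [|_ ->]; first by lia.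
pose snd (F : lists) := size F = M /\
  forall x y, y \in nth [::] F x -> y \in verts st /\ y != x.
pose Inv (r : seq nat) F := snd F /\ forall x, x \in verts st -> x \notin r -> nth [::] F x != [::].
apply: runs_weaken (@runs_for_each _ _ N (10 * N) _ Inv _ _ N_gt0 (verts_size cst) _ _) _ _.
- move=> x r F xv [sF neF].
  apply: (runs_bind (runs_get_list _ _)) => [|_ ->]; first by lia.
  set l := nth [::] (neg_adj st) x.
  (* Either no neighbor has been treated or [x] already has an arc; at the end the first case would
     make the list of [x] empty, against [ne]. *)
  pose Inv' (r' : seq nat) F' := [/\ snd F', forall u, nth [::] F u != [::] -> nth [::] F' u != [::]
    & r' = l \/ nth [::] F' x != [::]].
  apply: runs_weaken (@runs_for_each _ _ N 5 _ Inv' _ _ N_gt0 (neg_size x cst) _ _) _ _.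
  + move=> y r' F' yl [[szF' sndF'] neF' _].
    have yv := neg_verts cst yl.
    apply: (runs_bind (runs_bar_verts cst yv)) => // _ ->.
    apply: runs_weaken (runs_push_at _ _ _) _ _ => // _ ->.
    split; [split| |by right; rewrite nth_set_nth /= eqxx].
    * rewrite size_set_nth szF'; apply/maxn_idPr; exact: verts_lt cst xv.
    * move=> u z; rewrite nth_set_nth /=; case: eqP => [->|_]; last exact: sndF'.
      rewrite in_cons => /predU1P[->|/sndF'//]; split; first exact: pv.
      by apply: contraTneq yl => <-; rewrite -{1}[y]other_partK pe.
    * by move=> u /neF'; rewrite nth_set_nth /=; have [_|_] := eqVneq u x.
  + by split=> //; left.
  + by lia.
  + move=> F' [sF' neF' neFx]; split=> // u uv ur.
    have [->|ux] := eqVneq u x; last by apply: neF'; apply: neF => //; rewrite in_cons negb_or ux.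
    by case: neFx => // El; have := ne x xv; rewrite -/l -El.
- split; last by move=> x ->.
  by split=> [|x y]; rewrite ?size_nseq // nth_nseq if_same.
- by lia.
- by move=> F [[szF sndF] neF]; split=> // x xv; apply: neF.
Qed.

Lemma runs_step11 st : core M N st -> paired st -> 0 < size (verts st) ->
  (forall x, x \in verts st -> nth [::] (neg_adj st) x != [::]) ->
  runs (step11 st) (300 * (N * N * N)) (progress st).
Proof.
move=> cst pst v0 ne.
apply: (runs_bind (runs_forcing_graph cst pst ne)) => [|F [szF neF sndF]]; first by lia.
have bv := graph_verts (core_graph cst).
apply: (runs_bind (runs_find_cycle leMN szF bv v0 neF _)) => [v w _ /sndF //||].
  by lia.
move=> _ [c [-> uc sub szc]].
by apply: runs_weaken (runs_step12 cst pst uc sub szc) _ _ => //; lia.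
Qed.

Lemma runs_step10 st : core M N st -> paired st ->
  (forall x, x \in verts st -> nth [::] (neg_adj st) x != [::]) ->
  runs (step10 st) (400 * (N * N * N)) (progress st).
Proof.
move=> cst pst ne.
apply: (runs_bind (runs_is_empty _)) => [|_ ->]; first by lia.
case: ifPn => [_|v0]; last first.
  apply: runs_weaken (runs_step11 cst pst _ ne) _ _ => //; last by lia.
  by rewrite lt0n.
have le_SN : size (cover_S st) <= N by apply: leq_trans (leq_addr _ _) (core_size cst).
apply: (runs_bind (runs_for_each (k := 4 * N) (N := N) (Inv := fun _ _ => True)
  N_gt0 le_SN _ _)) => // [x r l xS _||l _]; last exact: runs_ret.
  apply: (runs_bind (runs_get_list _ _)) => [|_ ->]; first by lia.
  apply: runs_weaken (@runs_for_each _ _ N 1 _ (fun _ _ => True) _ _ N_gt0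
    (core_cover_groups cst xS) _ _) _ _ => //; last by lia.
  by move=> v _ l' _ _; apply: runs_weaken (runs_push _ _) _ _.
by lia.
Qed.

(** A vertex has exactly one positive neighbor, so degree one means an empty negative list. A failed
    search therefore gives every vertex a negative neighbor, which Step 11 needs for its forcing
    graph. *)
Lemma runs_step9 st : core M N st -> paired st ->
  runs (step9 st) (500 * (N * N * N)) (progress st).
Proof.
move=> cst pst.
apply: (runs_bind (runs_find_first (k := 6 * N) (N := N)
  (R := fun x b => b = (nth [::] (neg_adj st) x == [::]))
  N_gt0 (verts_size cst) _)) => [x xv||].
- apply: (runs_bind (runs_get_list _ _)) => [|_ ->]; first by lia.
  apply: (runs_bind (runs_get_list _ _)) => [|_ ->]; first by lia.
  rewrite (core_matched cst) ?(verts_lt cst) //.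
  apply: (runs_bind (@runs_count_cells N N_gt0 _ [:: _] _)) => // [|_ ->]; first by lia.
  apply: (runs_bind (runs_count_cells N_gt0 (neg_size x cst))) => // [|_ ->]; first by lia.
  by apply: runs_ret; rewrite add1n eqSS size_eq0.
- by lia.
case=> [x [xv _]|ne].
  apply: (runs_bind (runs_select N_gt0 leMN cst pst xv)) => [|st' Hst']; first by lia.
  exact: runs_ret.
apply: runs_weaken (runs_step10 cst pst _) _ _ => //; last by lia.
by move=> x /ne <-.
Qed.

(** Both outcomes are tied to one predicate [P], because Step 8 repeats this search at the vertex it
    has found and must succeed again. *)
Lemma runs_opposite_neighbor st x : core M N st -> paired st -> x \in verts st ->
  let P y := [&& other_part y \in nth [::] (neg_adj st) (other_part x),
                 y != x & y != other_part x] in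
  runs (opposite_neighbor st x) (12 * (N * N)) (fun o => match o with
    | Some y => y \in nth [::] (neg_adj st) x /\ P y
    | None => ~~ has P (nth [::] (neg_adj st) x) end).
Proof.
move=> cst pst xv P.
apply: (runs_bind (runs_bar_verts cst xv)) => [|_ ->]; first by lia.
apply: (runs_bind (runs_get_list _ _)) => [|_ ->]; first by lia.
apply: runs_weaken (@runs_find_first _ N (5 * N) _ (fun y b => b = P y) _ N_gt0
  (neg_size x cst) _) _ _ => [y yl||[y [yl <-]//|nP]].
- apply: (runs_bind (runs_bar_verts cst (neg_verts cst yl))) => [|_ ->]; first by lia.
  apply: (runs_bind (runs_adjacent N_gt0 leMN _ _ (graph_lists (core_graph cst)))).
    by lia.
  by move=> _ ->; apply: runs_ret.
- by lia.
- by apply/hasPn => y /nP <-.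
Qed.

Lemma runs_step8 st : core M N st -> paired st ->
  runs (step8 st) (700 * (N * N * N)) (progress st).
Proof.
move=> cst pst.
pose P x y := [&& other_part y \in nth [::] (neg_adj st) (other_part x),
  y != x & y != other_part x].
apply: (runs_bind (runs_find_first (k := 12 * (N * N)) (N := N)
  (R := fun x b => b = has (P x) (nth [::] (neg_adj st) x))
  N_gt0 (verts_size cst) _)) => [x xv||].
- apply: (runs_bind (runs_opposite_neighbor cst pst xv)) => [|[y [yl Py]|nP]].
  + by lia.
  + by apply: runs_ret; apply/esym/hasP; exists y.
  + by apply: runs_ret; exact: esym (negPf nP).
- by lia.
case=> [x [xv /esym hasP]|_]; last first.
  by apply: runs_weaken (runs_step9 cst pst) _ _ => //; lia.
apply: (runs_bind (runs_opposite_neighbor cst pst xv)) => [|[y|]]; first by lia.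
  2: by rewrite -/(P x) hasP.
case=> yl /and3P[_ yx yx'].
have yv := neg_verts cst yl; have [pv pe] := pst.
apply: (runs_bind (runs_bar_verts cst xv)) => [|_ ->]; first by lia.
apply: (runs_bind (runs_bar_verts cst yv)) => [|_ ->]; first by lia.
(* As [y] is neither [x] nor its mate, the two pairs are distinct, so both identifications remove a
   vertex. *)
have y'x : other_part y != x by rewrite other_part_eq.
apply: (runs_bind (runs_identify N_gt0 leMN cst xv (pv y yv) y'x)) => [|st1 [c1 v1 s1]].
  by lia.
have x'v1 : other_part x \in verts st1.
  by rewrite v1 mem_remove (inj_eq (can_inj other_partK)) eq_sym yx pv.
have yv1 : y \in verts st1 by rewrite v1 mem_remove eq_sym other_part_neq.
apply: (runs_bind (runs_identify N_gt0 leMN c1 x'v1 yv1 yx')) => [|st2 [c2 v2 s2]].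
  by lia.
have mem2 u : (u \in verts st2) = [&& u != y, u != other_part y & u \in verts st].
  by rewrite v2 v1 !mem_remove.
apply: (runs_bind (runs_delete_mate_edge pst c2 _ _ _)) => [||z u||st3 [c3 p3 v3]].
- by rewrite mem2 xv eq_sym yx [_ == other_part y]eq_sym y'x.
- move=> u; rewrite !mem2 => /and3P[u1 u2 u3].
  by rewrite !other_part_eq other_partK u1 u2 pv.
- move=> zx zx' ux ux' /(s2 z u zx' ux'); exact: s1.
- by lia.
apply: runs_ret; split=> //; rewrite v3.
apply: (size_strict_subset (x := y)) => //.
- exact: below_uniq (graph_verts (core_graph c2)).
- by move=> u; rewrite mem2 => /and3P[].
- by rewrite mem2 eqxx.
Qed.

(** Selecting the mate of any vertex shrinks the graph, so the search is recorded by its cost alone;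
    Steps 4 and 6 are treated in the same way. *)
Lemma runs_step7 st : core M N st -> paired st ->
  runs (step7 st) (800 * (N * N * N)) (progress st).
Proof.
move=> cst pst.
apply: (runs_bind (runs_find_first (k := 7 * (N * N)) (N := N)
  (R := fun _ _ => True) N_gt0 (verts_size cst) _)) => [x xv||].
- apply: (runs_bind (runs_get_list _ _)) => [|_ ->]; first by lia.
  apply: (runs_bind (@runs_find_first _ N (4 * N) _ (fun _ _ => True) _ N_gt0
    (neg_size x cst) _)) => [y yl||o _]; [|by lia|exact: runs_ret].
  apply: (runs_bind (runs_bar_verts cst (neg_verts cst yl))) => [|_ ->]; first by lia.
  by apply: runs_weaken (runs_list_mem N_gt0 _ (neg_size x cst)) _ _ => //; lia.
- by lia.
case=> [x [xv _]|_].
  apply: (runs_bind (runs_select_bar N_gt0 leMN cst pst xv)) => [|st' Hst']; first by lia.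
  exact: runs_ret.
by apply: runs_weaken (runs_step8 cst pst) _ _ => //; lia.
Qed.

Lemma runs_has_loop st x : core M N st -> runs (has_loop st x) (3 * N) (fun=> True).
Proof.
move=> cst; apply: runs_weaken (runs_adjacent N_gt0 leMN _ _ _) _ _ => //.
exact: graph_lists (core_graph cst).
Qed.

Lemma runs_step6 st : core M N st -> paired st ->
  runs (step6 st) (900 * (N * N * N)) (progress st).
Proof.
move=> cst pst.
apply: (runs_bind (runs_find_first (k := 3 * N) (N := N)
  (R := fun _ _ => True) N_gt0 (verts_size cst) _)) => [x xv||].
- exact: runs_has_loop.
- by lia.
case=> [x [xv _]|_].
  apply: (runs_bind (runs_select_bar N_gt0 leMN cst pst xv)) => [|st' Hst']; first by lia.
  exact: runs_ret.
by apply: runs_weaken (runs_step7 cst pst) _ _ => //; lia.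
Qed.

Lemma runs_step5 st : core M N st -> paired st ->
  runs (step5 st) (1000 * (N * N * N)) (progress st).
Proof.
move=> cst pst.
apply: (runs_bind (runs_find_first (k := 8 * N) (N := N)
  (R := fun _ _ => True) N_gt0 (verts_size cst) _)) => [x xv||].
- apply: (runs_bind (runs_bar_verts cst xv)) => [|_ ->]; first by lia.
  apply: (runs_bind (runs_has_loop x cst)) => [|b _]; first by lia.
  apply: (runs_bind (runs_has_loop _ cst)) => [|b' _]; first by lia.
  exact: runs_ret.
- by lia.
case=> [x [xv _]|_]; first exact: runs_ret.
by apply: runs_weaken (runs_step6 cst pst) _ _ => //; lia.
Qed.

Lemma forbidden_size st : core M N st -> size (forbidden_B st) <= N.
Proof. by move=> cst; apply: leq_trans (below_size (core_forbidden cst)) leMN. Qed.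

Lemma runs_step4 st : core M N st -> paired st ->
  runs (step4 st) (1100 * (N * N * N)) (progress st).
Proof.
move=> cst pst.
apply: (runs_bind (runs_find_first (k := 2 * N) (N := N)
  (R := fun _ _ => True) N_gt0 (verts_size cst) _)) => [x xv||].
- exact: runs_weaken (runs_list_mem N_gt0 _ (forbidden_size cst)) _ _.
- by lia.
case=> [x [xv _]|_]; last by apply: runs_weaken (runs_step5 cst pst) _ _ => //; lia.
apply: (runs_bind (runs_select_bar N_gt0 leMN cst pst xv)) => [|st' [c' p' lt']].
  by lia.
apply: (runs_bind (runs_list_remove N_gt0 _ (forbidden_size c'))) => [|_ ->].
  by lia.
apply: runs_ret; split=> //; last by case: p'.
by case: c' => *; split=> //=; apply: below_filter.
Qed.

Lemma runs_step3 st : core M N st -> paired st ->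
  runs (step3 st) (1200 * (N * N * N)) (progress st).
Proof.
move=> cst pst.
apply: (runs_bind (runs_find_first (k := 6 * N) (N := N)
  (R := fun _ _ => True) N_gt0 (verts_size cst) _)) => [x xv||].
- apply: (runs_bind (runs_bar_verts cst xv)) => [|_ ->]; first by lia.
  apply: (runs_bind (runs_list_mem N_gt0 _ (forbidden_size cst))) => [|b _]; first by lia.
  apply: (runs_bind (runs_list_mem N_gt0 _ (forbidden_size cst))) => [|b' _]; first by lia.
  exact: runs_ret.
- by lia.
case=> [x [xv _]|_]; first exact: runs_ret.
by apply: runs_weaken (runs_step4 cst pst) _ _ => //; lia.
Qed.

Lemma runs_main_loop st : core M N st -> paired st ->
  runs (loop step3 st) (1201 * (N * N * N) * N.+1) (fun=> True).
Proof.
move=> cst pst.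
apply: (@runs_weaken _ _ (1201 * (N * N * N) * (size (verts st)).+1) _ (fun=> True)) => //.
  (* Of the 1201 N^3 per vertex, 1200 N^3 pay a round and the rest covers the unit charged by
     [loop]; the successor leaves room for the round that returns an answer. *)
  apply: (runs_loop (Inv := fun st => core M N st /\ paired st)
    (phi := fun st => 1201 * (N * N * N) * (size (verts st)).+1)) => // st' [c' p'].
  exists (1200 * (N * N * N)); first by nia.
  by apply: runs_weaken (runs_step3 c' p') _ _ => // -[st2|//] [c2 p2 lt]; split=> //; nia.
by rewrite leq_mul2l ltnS (verts_size cst) orbT.
Qed.

End Steps.

(** * Steps 1 and 2 *)

Section Collapse.
Variables V N : nat.
Hypotheses (N_gt0 : 0 < N) (leVN : V <= N).

Let sqr_ge : N <= N * N. Proof. by nia. Qed.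
Let cube_ge : N * N <= N * N * N. Proof. by nia. Qed.

Lemma runs_step1 pos neg : size pos = V -> lists_below V neg ->
  (forall v w, w \in nth [::] neg v -> v \in nth [::] neg w) ->
  runs (step1 pos neg) (20 * (N * N)) (fun r =>
    [/\ below V r.1, forall v, v \in r.1 -> below V (nth [::] r.2 v)
      & forall v w, v \in r.1 -> w \in nth [::] r.2 v ->
          w \in r.1 /\ v \in nth [::] r.2 w]).
Proof.
move=> sp bn sym.
pose P v := ~~ nilp (nth [::] pos v).
have runsP v : runs (let! l := get_list pos v in let! e := is_empty l in ret (~~ e)) 2
    (fun b => b = P v).
  apply: (runs_bind (runs_get_list _ _)) => // _ ->.
  by apply: (runs_bind (runs_is_empty _)) => // _ ->; apply: runs_ret.
apply: (runs_bind (runs_array_length _)) => [|_ ->]; first by lia.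
rewrite sp; apply: (runs_bind (runs_numbers_below _)) => [|_ ->]; first by lia.
have le_iN : size (iota 0 V) <= N by rewrite size_iota.
apply: (runs_bind (runs_keep N_gt0 le_iN (fun x _ => runsP x))) => [|_ ->]; first by lia.
set vs := [seq v <- iota 0 V | P v].
have bvs : below V vs by apply: below_filter; apply: below_iota.
have le_vN : size vs <= N by apply: leq_trans (below_size bvs) leVN.
(* Each list is original or already filtered, and filtering is idempotent, so treating a list gives
   the same result in both cases. *)
pose Inv (r : seq nat) (ng : lists) :=
  (forall v, nth [::] ng v = nth [::] neg v \/
     nth [::] ng v = [seq w <- nth [::] neg v | P w]) /\
  (forall v, v \in vs -> v \notin r -> nth [::] ng v = [seq w <- nth [::] neg v | P w]).
apply: (runs_bind (@runs_for_each _ _ N (7 * N) _ Inv _ _ N_gt0 le_vN _ _)).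
- move=> v r ng vvs [H1 H2].
  apply: (runs_bind (runs_get_list _ _)) => [|_ ->]; first by lia.
  have Ef : [seq w <- nth [::] ng v | P w] = [seq w <- nth [::] neg v | P w].
    by case: (H1 v) => ->; rewrite ?filter_id.
  have le_lN : size (nth [::] ng v) <= N.
    apply: leq_trans (lists_below_size leVN v bn); case: (H1 v) => -> //.
    by rewrite size_filter count_size.
  apply: (runs_bind (runs_keep N_gt0 le_lN (fun x _ => runsP x))) => [|_ ->]; first by lia.
  apply: runs_weaken (runs_array_set _ _ _ _) _ _ => [|_ ->]; first by lia.
  rewrite Ef; split=> u; rewrite nth_set_nth /=.
    by case: (u =P v) => [->|_]; [right|apply: H1].
  have [->//|uv] := eqVneq u v => uvs ur.
  by apply: H2 => //; rewrite in_cons negb_or uv.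
- by split=> [v|v ->]; first left.
- by lia.
move=> ng [_ Eng]; apply: runs_ret => /=; split=> // [v vvs|v w vvs].
  by rewrite Eng //; apply: below_filter; case: bn.
rewrite Eng // mem_filter => /andP[Pw wv].
have wvs : w \in vs by rewrite mem_filter Pw mem_iota (below_lt _ wv) //; case: bn.
split=> //; rewrite Eng // mem_filter sym // andbT.
by move: vvs; rewrite mem_filter => /andP[].
Qed.

Definition labelled_below (lab : labels) (k : nat) : Prop :=
  size lab = V /\ forall v c, nth None lab v = Some c -> c < k.

Lemma runs_label_component pos lab v r : lists_below V pos ->
  labelled_below lab r.*2 -> v < V ->
  runs (label_component pos lab v r.*2) (30 * (N * N)) (fun o =>
    if o is Some lab' then [/\ labelled_below lab' r.+1.*2, isSome (nth None lab' v)
      & forall u, isSome (nth None lab u) -> isSome (nth None lab' u)] else True).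
Proof.
move=> bp [sl ll] ltv.
(* Labelling a vertex may push [N] entries worth 4 each and costs [3 * N + 4] itself, whence
   [7 * N + 10] per unlabelled vertex; a vertex already labelled is paid by its stack entry. *)
pose phi (s : seq (nat * nat) * labels) :=
  4 * size s.1 + (7 * N + 10) * count (fun o => ~~ isSome o) s.2 + 2.
(* The third clause ensures that the starting vertex is labelled when the stack runs empty. The new
   labels are [r.*2] and its mate, both below [r.+1.*2]. *)
pose Inv (s : seq (nat * nat) * labels) :=
  [/\ labelled_below s.2 r.+1.*2,
      forall x, x \in s.1 -> x.1 < V /\ x.2 < r.+1.*2,
      s.1 = [:: (v, r.*2)] \/ isSome (nth None s.2 v)
    & forall u, isSome (nth None lab u) -> isSome (nth None s.2 u)].
apply: (@runs_weaken _ _ (phi ([:: (v, r.*2)], lab))) (_ : runs _ _ _) _ (fun _ => id);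
  last first.
  rewrite /phi /=; have := count_size (fun o => ~~ isSome o) lab; rewrite sl; nia.
apply: (runs_loop (Inv := Inv) (phi := phi)); last first.
  split=> //=; last by left.
    by split=> // u c /ll; lia.
  by move=> x; rewrite inE => /eqP-> /=; split=> //; lia.
case=> [[|[u d] stack] lab'] [[/= sl' ll'] good vlab ext].
  exists 1; first by rewrite /phi /=; lia.
  by apply: (runs_bind (runs_pop _)) => // _ ->; apply: runs_ret; split=> //; case: vlab.
have [ltu ltd] := good _ (mem_head _ _).
have good' x : x \in stack -> x.1 < V /\ x.2 < r.+1.*2.
  by move=> xs; apply: good; rewrite in_cons xs orbT.
case E: (nth None lab' u) => [d'|].
  exists 2; first by rewrite /phi /=; lia.
  apply: (runs_bind (runs_pop _)) => // _ -> /=.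
  apply: (runs_bind (runs_array_get _ _ _)) => // _ ->; rewrite E.
  case: ifP => _; apply: runs_ret => //; split; last by rewrite /phi /=; lia.
  by split=> //=; right; case: vlab => // -[<- _ _]; rewrite E.
have cnt : count (fun o => ~~ isSome o) (set_nth None lab' u (Some d)) + 1 =
    count (fun o => ~~ isSome o) lab'.
  rewrite count_set_nth_ltn ?sl' // E addn0 subnK // -has_count.
  by apply/(has_nthP None); exists u; rewrite ?sl' ?E.
have le_pN := lists_below_size leVN u bp.
exists (3 * N + 4).
  by rewrite /phi /= -cnt; nia.
apply: (runs_bind (runs_pop _)) => [|_ -> /=]; first by lia.
apply: (runs_bind (runs_array_get _ _ _)) => [|_ ->]; first by lia.
rewrite E; apply: (runs_bind (runs_array_set _ _ _ _)) => [|_ ->]; first by lia.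
apply: (runs_bind (runs_get_list _ _)) => [|_ ->]; first by lia.
set l := nth [::] pos u in le_pN *.
pose Inv' (q : seq nat) (st : seq (nat * nat)) := size st + size q = size stack + size l /\
  forall x, x \in st -> x.1 < V /\ x.2 < r.+1.*2.
apply: (runs_bind (@runs_for_each _ _ N 1 _ Inv' _ _ N_gt0 le_pN _ _)) => //.
- move=> w q st wl [szs goods]; apply: runs_weaken (runs_push _ _) _ _ => // _ ->.
  split=> [|x]; first by rewrite /= addSnnS.
  rewrite in_cons => /predU1P[->/=|/goods//]; split; last exact: other_part_lt.
  exact: below_lt (bp.2 u) wl.
- by lia.
move=> stack' [szs goods]; apply: runs_ret; split; last first.
  by rewrite /phi /= -cnt; rewrite /= addn0 in szs; nia.
split=> //=.
- split; first by rewrite size_set_nth sl'; apply/maxn_idPr.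
  by move=> w c; rewrite nth_set_nth /=; case: eqP => [_ [<-]|_ /ll'].
- right; rewrite nth_set_nth /=; case: eqP => // vu.
  by case: vlab => // -[uv _ _]; rewrite uv in vu.
- by move=> w /ext; rewrite nth_set_nth /=; case: eqP.
Qed.

Lemma runs_label_components pos vs : lists_below V pos -> below V vs ->
  runs (label_components pos vs) (40 * (N * N * N)) (fun o =>
    if o is Some (lab, r) then
      [/\ labelled_below lab r.*2, r <= V & forall v, v \in vs -> isSome (nth None lab v)]
    else True).
Proof.
move=> bp bvs; have le_vN : size vs <= N by apply: leq_trans (below_size bvs) leVN.
apply: (runs_bind (runs_array_length _)) => [|_ ->]; first by lia.
rewrite bp.1; apply: (runs_bind (runs_new_array _ _)) => [|_ ->]; first by lia.
(* A new component uses up the vertex it starts from, so there are at most V components; this is why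
   the collapsed graph has at most 2V vertices. *)
pose Inv (q : seq nat) (o : option (labels * nat)) := if o is Some (lab, r) then
  [/\ labelled_below lab r.*2, r + size q <= V
    & forall v, v \in vs -> v \notin q -> isSome (nth None lab v)] else True.
apply: runs_weaken (@runs_for_each _ _ N (31 * (N * N)) _ Inv _ _ N_gt0 le_vN _ _) _ _.
- move=> v q [[lab r]|] vvs; last by move=> _; apply: runs_ret.
  case=> ll szr lbl; apply: (runs_bind (runs_array_get _ _ _)) => [|_ ->]; first by lia.
  case E: (nth None lab v) => [c|].
    apply: runs_ret; split=> // [|u uvs uq]; first by rewrite /= in szr; lia.
    have [->|uv] := eqVneq u v; first by rewrite E.
    by apply: lbl => //; rewrite in_cons negb_or uv.
  apply: (runs_bind (runs_label_component bp ll (below_lt bvs vvs))) => [|o Ho].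
    by lia.
  case: o Ho => [lab'|_]; last exact: runs_ret.
  case=> ll' lv ext; apply: runs_ret; split=> // [|u uvs uq].
    by rewrite /= in szr; lia.
  have [->//|uv] := eqVneq u v.
  by apply/ext/lbl => //; rewrite in_cons negb_or uv.
- split=> [|/=|v ->//]; last exact: below_size.
  by split=> [|v c]; rewrite ?size_nseq // nth_nseq if_same.
- by lia.
- by move=> [[lab r]|//] [ll szr lbl]; split=> // [|v vvs]; [lia|apply: lbl].
Qed.

(** Symmetry fails in the middle of the loop, which inserts arcs from one end at a time. It is
    recovered at the end: every entry is the image of an input edge, every such edge is represented,
    and the input lists are symmetric. *)
Lemma runs_collapse vs neg lab r : r.*2 <= N -> below V vs ->
  (forall v, v \in vs -> below V (nth [::] neg v)) ->
  (forall v w, v \in vs -> w \in nth [::] neg v -> w \in vs /\ v \in nth [::] neg w) ->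
  labelled_below lab r.*2 -> (forall v, v \in vs -> isSome (nth None lab v)) ->
  runs (collapse vs neg lab r) (40 * (N * N * N)) (fun st =>
    core r.*2 N st /\ paired st).
Proof.
set M := r.*2 => leMN bvs bneg closed ll lbl.
pose lb v := odflt 0 (nth None lab v).
have lb_lt v : v \in vs -> lb v < M.
  by move=> /lbl; rewrite /lb; case E: (nth None lab v) => [c|//] _; case: ll => _ /(_ v c E).
have runs_lb v : v \in vs -> runs (let! o := get_label lab v in
    if o is Some c then ret c else diverge) 1 (fun c => c = lb v).
  move=> /lbl lv; apply: (runs_bind (runs_array_get _ _ _)) => // _ ->.
  by rewrite /lb; case: nth lv => // c _; apply: runs_ret.
have le_vN : size vs <= N by apply: leq_trans (below_size bvs) leVN.
have le_iN : size (iota 0 M) <= N by rewrite size_iota.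
apply: (runs_bind (runs_numbers_below _)) => [|_ ->]; first by lia.
apply: (runs_bind (runs_new_array _ _)) => [|_ ->]; first by lia.
pose Inv1 (q : seq nat) (p : lists) := uniq q /\
  forall x, x < M -> nth [::] p x = if x \in q then [::] else [:: other_part x].
apply: (runs_bind (@runs_for_each _ _ N 3 _ Inv1 _ _ N_gt0 le_iN _ _)).
- move=> c q p ci [/= /andP[cq uq] Ep]; apply: runs_weaken (runs_push_at _ _ _) _ _ => // _ ->.
  rewrite mem_iota in ci; split=> // x ltx; rewrite nth_set_nth /=.
  have [->|xc] := eqVneq x c; first by rewrite (negPf cq) Ep // mem_head.
  by rewrite Ep // in_cons (negPf xc).
- split; first exact: iota_uniq.
  by move=> x ltx; rewrite nth_nseq if_same mem_iota ltx.
- by lia.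
move=> pos1 [_ Epos].
apply: (runs_bind (runs_new_array _ _)) => [|_ ->]; first by lia.
(* Each input vertex enters a single group, so the groups together never exceed V. *)
pose Inv2 (q : seq nat) (gr : lists) :=
  \sum_(x <- iota 0 M) size (nth [::] gr x) + size q <= V.
apply: (runs_bind (@runs_for_each _ _ N 4 _ Inv2 _ _ N_gt0 le_vN _ _)).
- move=> v q gr vvs szg; apply: (runs_bind (runs_lb v vvs)) => // _ ->.
  apply: runs_weaken (runs_push_at _ _ _) _ _ => // _ ->.
  have li : lb v \in iota 0 M by rewrite mem_iota lb_lt.
  move: szg; rewrite /Inv2 !(bigD1_seq _ li (iota_uniq _ _)) /= nth_set_nth /= eqxx /=.
  rewrite -addSnnS -!addSn => szg; apply: leq_trans szg; rewrite leq_add2r leq_add2l.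
  by apply: leq_sum => x /negPf xl; rewrite nth_set_nth /= xl.
- rewrite /Inv2 big1 => [|x _]; first exact: below_size.
  by rewrite nth_nseq if_same.
- by lia.
move=> gr; rewrite /Inv2 addn0 => szg.
apply: (runs_bind (runs_new_array _ _)) => [|_ ->]; first by lia.
(* The image of a negative edge under the labelling, edges between the two parts of a component
   being dropped. *)
pose arc a b := exists v w, [/\ v \in vs, w \in nth [::] neg v, lb v = a, lb w = b
  & b != other_part a].
pose Inv3 (q : seq nat) (ng : lists) := [/\ lists_below M ng,
  forall a b, b \in nth [::] ng a -> arc a b
  & forall v w, v \in vs -> w \in nth [::] neg v -> v \notin q ->
      lb w != other_part (lb v) -> lb w \in nth [::] ng (lb v)].
apply: (runs_bind (@runs_for_each _ _ N (10 * (N * N)) _ Inv3 _ _ N_gt0 le_vN _ _)).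
- move=> v q ng vvs [bng snd cmp].
  apply: (runs_bind (runs_lb v vvs)) => [|_ ->]; first by lia.
  apply: (runs_bind (runs_get_list _ _)) => [|_ ->]; first by lia.
  have le_nN : size (nth [::] neg v) <= N.
    by apply: leq_trans leVN; apply: below_size; apply: bneg.
  pose Inv4 (q' : seq nat) (ng' : lists) := [/\ lists_below M ng',
    forall a b, b \in nth [::] ng' a -> arc a b,
    forall a b, b \in nth [::] ng a -> b \in nth [::] ng' a
    & forall w, w \in nth [::] neg v -> w \notin q' -> lb w != other_part (lb v) ->
        lb w \in nth [::] ng' (lb v)].
  apply: runs_weaken (@runs_for_each _ _ N (6 * N) _ Inv4 _ _ N_gt0 le_nN _ _) _ _.
  + move=> w q' ng' wv [bng' snd' mon' cmp'].
    have [wvs _] := closed v w vvs wv.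
    apply: (runs_bind (runs_lb w wvs)) => [|_ ->]; first by lia.
    case: ifPn => lw.
      apply: runs_ret; split=> // u uv uq' lu; apply: cmp' => //.
      by rewrite in_cons negb_or uq' andbT; apply: contraNneq lu => ->.
    apply: runs_weaken (runs_insert_at N_gt0 leMN bng' (lb_lt v vvs) (lb_lt w wvs)) _ _.
      by lia.
    move=> ng2 [b2 E2]; split=> // [a b|a b /mon'|u uv uq' lu]; rewrite E2.
    * by case/orP=> [/snd'//|/andP[/eqP-> /eqP->]]; exists v, w.
    * by move=> ->.
    * have [->|uw] := eqVneq u w; first by rewrite !eqxx orbT.
      by rewrite cmp' // in_cons negb_or uw.
  + by split=> // w ->.
  + by lia.
  + move=> ng' [bng' snd' mon' cmp']; split=> // u w uvs wu uq lw.
    have [uv|uv] := eqVneq u v; first by rewrite uv in wu lw *; apply: cmp'.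
    by apply/mon'/cmp => //; rewrite in_cons negb_or uv.
- split; first exact: lists_below_nseq.
    by move=> a b; rewrite nth_nseq if_same.
  by move=> v w ->.
- by lia.
move=> ng [bng snd cmp]; apply: runs_ret; split; split=> //=.
- split=> //; first exact: below_iota.
    move=> a b /snd[v [w [vvs wv <- <- n]]]; have [wvs vw] := closed v w vvs wv.
    by apply: cmp; rewrite // -other_part_eq eq_sym.
  move=> a b /snd[v [w [vvs wv _ <- _]]]; have [wvs _] := closed v w vvs wv.
  by rewrite mem_iota lb_lt.
- exact: leq_trans szg leVN.
- by move=> x; rewrite !mem_iota; apply: other_part_lt.
- by move=> x; apply/negP=> /snd[v [w [_ _ _ _]]]; rewrite eqxx.
Qed.

Lemma runs_step2 pos vs neg : V.*2 <= N -> lists_below V pos -> below V vs ->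
  (forall v, v \in vs -> below V (nth [::] neg v)) ->
  (forall v w, v \in vs -> w \in nth [::] neg v -> w \in vs /\ v \in nth [::] neg w) ->
  runs (step2 pos vs neg) (80 * (N * N * N)) (fun o =>
    if o is Some st then exists M, [/\ M <= N, core M N st & paired st] else True).
Proof.
move=> le2VN bp bvs bneg closed.
apply: (runs_bind (runs_label_components bp bvs)) => [|[[lab r]|] Hlab].
- by lia.
- have [ll le_rV lbl] := Hlab; have leMN : r.*2 <= N by lia.
  apply: (runs_bind (runs_collapse leMN bvs bneg closed ll lbl)) => [|st [cst pst]].
    by lia.
  by apply: runs_ret; exists r.*2.
- exact: runs_ret.
Qed.

End Collapse.

(** Steps 1 and 2 cost 20 N^2 and 80 N^3, and the loop costs 1201 N^3 (N + 1) <= 2402 N^4; the sum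
    is rounded up to 2600 N^4. *)
Lemma runs_MaxDef V pos neg : 0 < V -> lists_below V pos -> lists_below V neg ->
  (forall v w, w \in nth [::] neg v -> v \in nth [::] neg w) ->
  runs (MaxDef pos neg) (2600 * V.*2 ^ 4) (fun=> True).
Proof.
move=> V_gt0 bp bn sym; set N := V.*2.
have N_gt0 : 0 < N by rewrite /N; lia.
have leVN : V <= N by rewrite /N; lia.
have sqr_ge : N <= N * N by nia.
have cube_ge : N * N <= N * N * N by nia.
have fourth_ge : N * N * N <= N * N * N * N by nia.
have -> : N ^ 4 = N * N * N * N by rewrite !expnS expn0 muln1 !mulnA.
apply: (runs_bind (runs_step1 N_gt0 leVN bp.1 bn sym)) => [|[vs ng] [/= bvs bng cl]].
  by lia.
apply: (runs_bind (runs_step2 N_gt0 leVN (leqnn _) bp bvs bng cl)) => [|o Ho].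
  by lia.
case: o Ho => [st [M [leMN cst pst]]|_]; last exact: runs_ret.
apply: runs_weaken (runs_main_loop N_gt0 leMN cst pst) _ _ => //.
by rewrite mulnS; lia.
Qed.

(** * Adjacency lists of a signed graph without multiple edges of the same sign *)

Section Input.
Variable G : signed_graph.
Hypothesis simpleG : no_multiple_edges_of_same_sign G.

Lemma same_ends_opposite (e f : edge G) v : incident e v -> incident f v ->
  opposite e v = opposite f v -> same_ends e f.
Proof.
rewrite /incident /opposite /same_ends; case: (ends e) (ends f) => a b [c d] /=.
have [->|_] := eqVneq a v; have [->|_] /= := eqVneq c v; rewrite ?xpair_eqE.
- by move=> _ _ ->; rewrite !eqxx.
- by move=> _ /eqP-> ->; rewrite !eqxx orbT.
- by move=> /eqP-> _ ->; rewrite !eqxx orbT.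
- by move=> /eqP-> /eqP-> ->; rewrite !eqxx.
Qed.

Lemma opposite_incident (e : edge G) v : incident e v -> incident e (opposite e v).
Proof.
by rewrite /incident /opposite; have [_|_ _] := eqVneq; rewrite eqxx ?orbT.
Qed.

Lemma oppositeK (e : edge G) v : incident e v -> opposite e (opposite e v) = v.
Proof.
rewrite /incident /opposite; have [->|_ /= /eqP->] := eqVneq (ends e).1 v.
  by case: eqVneq => // ->.
by rewrite eqxx.
Qed.

Variable num : vertex G -> 'I_#|vertex G|.
Hypothesis num_bij : bijective num.

Lemma mem_adjacency s A v (w : nat) : adjacency_lists num s A ->
  reflect (exists e, [/\ positive e = s, incident e v & w = num (opposite e v)])
    (w \in nth [::] A (num v)).
Proof.
case=> _ /(_ v)/perm_mem->; apply: (iffP mapP) => [[e]|[e [es ev ->]]].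
  by rewrite mem_filter => /andP[/andP[/eqP es ev] _] ->; exists e.
by exists e => //; rewrite mem_filter es eqxx ev mem_enum.
Qed.

Lemma num_surj (i : nat) : i < #|vertex G| -> exists v, i = num v.
Proof.
by move=> lti; have [g _ gK] := num_bij; exists (g (Ordinal lti)); rewrite gK.
Qed.

(** The absence of multiple edges of the same sign enters here: equal entries in the list of [v]
    come from edges of the same sign with the same ends, hence from one edge. *)
Lemma adjacency_below s A : adjacency_lists num s A -> lists_below #|vertex G| A.
Proof.
move=> adjA; have [sA pA] := adjA; split=> // i.
have [lti|gei] := ltnP i #|vertex G|; last by rewrite nth_default // sA.
have [v ->] := num_surj lti; apply/andP; split; last first.
  by apply/allP=> w /(mem_adjacency _ _ adjA)[e [_ _ ->]]; apply: ltn_ord.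
rewrite (perm_uniq (pA v)) map_inj_in_uniq => [|e f].
  by apply: filter_uniq; apply: enum_uniq.
rewrite !mem_filter => /andP[/andP[/eqP es ev] _] /andP[/andP[/eqP fs fv] _].
move=> /val_inj/(bij_inj num_bij) eq_opp; apply: simpleG; first by rewrite es fs.
exact: same_ends_opposite ev fv eq_opp.
Qed.

Lemma adjacency_sym s A v w : adjacency_lists num s A ->
  w \in nth [::] A v -> v \in nth [::] A w.
Proof.
move=> adjA; have [ltv|gev] := ltnP v #|vertex G|; last first.
  by rewrite (nth_default _ (_ : size A <= v)) //; case: adjA => ->.
have [x ->] := num_surj ltv => /(mem_adjacency _ _ adjA)[e [es ex ->]].
by apply/(mem_adjacency _ _ adjA); exists e; rewrite opposite_incident ?oppositeK.
Qed.

End Input.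

(** A graph without vertices is properly colored by the empty color set, so its chromatic number
    would be 0. *)
Lemma three_chromatic_nonempty G : three_chromatic G -> 0 < #|vertex G|.
Proof.
case=> _ min; rewrite lt0n; apply/eqP=> /card0_eq empty.
have /min // : colorable G 0.
exists (fun=> ssrint.Posz 0); split=> [v|e]; first by have := empty v.
by have := empty (ends e).1.
Qed.

Theorem theorem4p1 :
  exists C : nat,
    forall (G : signed_graph) (pos neg : seq (seq nat)),
      represented_by G pos neg ->
      three_chromatic G ->
      no_multiple_edges_of_same_sign G ->
      terminates_within (MaxDef pos neg) (C * #|vertex G| ^ 5).
Proof.
(* The factor [2 ^ 4] comes from [N = 2V] in the bound 2600 N^4. *)
exists (2600 * 2 ^ 4) => G pos neg [num [num_bij adjp adjn]] chr simpleG.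
have V_gt0 := three_chromatic_nonempty chr.
have [run] := runs_MaxDef V_gt0 (adjacency_below simpleG num_bij adjp)
  (adjacency_below simpleG num_bij adjn) (fun v w => adjacency_sym num_bij adjn).
rewrite /terminates_within.
have [|a [t [-> _ _]]] // := run (2600 * 2 ^ 4 * #|vertex G| ^ 5).
by rewrite -muln2 expnMn [_ ^ 4 * _]mulnC mulnA leq_mul2l leq_pexp2l ?orbT.
Qed.
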